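(* Let the quartic $X$ be a general member of the family $\mathcal{T}$ and let $\ell=V(x_3,x_4)\subset X$. (a) The quartic $X$ is not given by Segre's construction with respect to $\ell$; that is, $X$ is not given by any equation $S+\hat L_1\cdots\hat L_4=0$ in which the quartic $S$ is a union of a family of lines, each of which meets $\ell$, and the planes $\hat L_1,\dots,\hat L_4$ meet along $\ell$. (b) The surface $S_8$ defined by $(X,\ell)$ consists of three planes and an irreducible quintic.
   Context: $\mathbb{K}$ is an algebraically closed field of characteristic different from $2$ and $3$. The same symbol is used for a homogeneous polynomial and its zero set. Family $\mathcal{T}$: quartics in $\mathbb{P}^3_{\mathbb{K}}$ given by the polynomials $$g-4c^3(b+4ac^3)x_1x_2x_4^2+b\,x_1x_2x_3x_4+a\,x_1x_2x_3^2+x_2^2(x_2-3cx_1)x_4+x_1^3x_3+\tfrac{1}{3}c(x_3-4c^3x_4)\big((b+4ac^3)x_4+ax_3\big)^2(cx_1+x_2),$$ where $a,b,c\in\mathbb{K}$, $c\neq0$, and $g\in\mathbb{K}[x_3,x_4]$ is homogeneous of degree $4$. ''General'' means: for parameters $(a,b,c,g)$ in some nonempty Zariski-open subset of the parameter space. A general member of $\mathcal{T}$ is smooth. For a smooth quartic $X$ containing a line $\ell$ and $P\in\ell$, $F_P$ denotes the plane cubic with $X\cap T_PX=\ell+F_P$. The surface $S_8$ defined by $(X,\ell)$ is the union of all lines in $$\mathfrak{S}_\ell=\{\tilde\ell\subset\mathbb{P}^3\text{ a line}:\ \exists P\in\ell\text{ with }\tilde\ell\subset T_PX\text{ and }i(\tilde\ell,F_P;P)\ge2\},$$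 where $i(\tilde\ell,F_P;P)$ is the intersection multiplicity at $P$ of $\tilde\ell$ and the cubic $F_P$ inside the plane $T_PX$ (taken to be $\infty$ if $P\in\tilde\ell\subset F_P$); it is a hypersurface in $\mathbb{P}^3$. *)

(* Defs.v *)
From HB Require Import structures.
From mathcomp Require Import all_boot all_order all_algebra.
From mathcomp Require Export mpoly.

Set Implicit Arguments.
Unset Strict Implicit.
Unset Printing Implicit Defensive.

Import GRing.Theory.
Local Open Scope ring_scope.

(* The coordinates x_1, ..., x_4 of P^3 are numbered from 0 in 'I_4. *)
Definition o1 : 'I_4 := @Ordinal 4 0 isT.
Definition o2 : 'I_4 := @Ordinal 4 1 isT.
Definition o3 : 'I_4 := @Ordinal 4 2 isT.
Definition o4 : 'I_4 := @Ordinal 4 3 isT.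

Section ProjectiveSpace.

Variable K : fieldType.

(* A point of P^3 is represented by a nonzero vector of K^4, a line by a
   2-dimensional subspace and a plane by a 3-dimensional subspace. *)
Notation vec := 'rV[K]_4.
Notation form := {mpoly K[4]}.

Definition is_line (m : {vspace vec}) : Prop := \dim m = 2%N.
Definition is_plane (H : {vspace vec}) : Prop := \dim H = 3%N.

Definition evalv (f : form) (v : vec) : K := f.@[fun i => v 0 i].

Definition vanishes (f : form) (v : vec) : Prop := evalv f v = 0.

(* f is an equation of a surface of degree d. *)
Definition is_form (d : nat) (f : form) : Prop := f \is d.-homog /\ f != 0.

Definition irreducible_form (f : form) : Prop :=
  [/\ f != 0, f \isn't a GRing.unit
    & forall g h : form, f = g * h -> g \is a GRing.unit \/ h \is a GRing.unit].

(* The line V(x_3, x_4). *)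
Definition line34 : {vspace vec} :=
  (<[delta_mx 0%R o1 : vec]> + <[delta_mx 0%R o2 : vec]>)%VS.

Lemma mem_line34 (v : vec) :
  (v \in line34) = (v 0 o3 == 0) && (v 0 o4 == 0).
Proof.
apply/idP/andP.
  move=> /memv_addP[u /vlineP[s ->] [w /vlineP[t ->] ->]].
  by rewrite !mxE /= !mulr0 addr0.
move=> [/eqP v3 /eqP v4]; apply/memv_addP.
exists (v 0 o1 *: delta_mx 0 o1); first by rewrite memvZ ?memv_line.
exists (v 0 o2 *: delta_mx 0 o2); first by rewrite memvZ ?memv_line.
apply/rowP=> j; rewrite !mxE /=.
have [->|->|->|->] : [\/ j = o1, j = o2, j = o3 | j = o4].
- by case: j => [[|[|[|[|j]]]] ltj] //;
    [constructor 1 | constructor 2 | constructor 3 | constructor 4];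
    apply: val_inj.
- by rewrite /= mulr1 mulr0 addr0.
- by rewrite /= mulr1 mulr0 add0r.
- by rewrite v3 /= !mulr0 addr0.
- by rewrite v4 /= !mulr0 addr0.
Qed.

(* The linear form sum_i (dX/dx_i)(P) x_i, whose zero set is T_P X when X is
   smooth at P. *)
Definition tangent_form (X : form) (P : vec) : form :=
  \sum_(i < 4) evalv X^`M(i) P *: 'X_i.

(* The quaternary cubic form C cuts out in T_P X the plane cubic F_P, i.e.
   X . T_P X = ell + F_P as divisors on the plane T_P X: modulo the equation
   of T_P X, the form X is lam * C, where lam = 0 is the equation of ell in
   T_P X.  Such a C is unique up to a nonzero scalar and up to multiples of the
   equation of T_P X, and so is its restriction to T_P X. *)
Definition residual_cubic (X : form) (ell : {vspace vec}) (P : vec) (C : form)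
    : Prop :=
  C \is 3.-homog /\
  exists lam D : form,
    [/\ lam \is 1.-homog,
        forall v, v \in ell <-> vanishes (tangent_form X P) v /\ vanishes lam v
      & X = lam * C + tangent_form X P * D].

(* The univariate polynomial f(P + t Q) in t. *)
Definition restrict_to_line (f : form) (P Q : vec) : {poly K} :=
  mmap polyC (fun i => (P 0 i)%:P + Q 0 i *: 'X) f.

(* Intersection multiplicity at P of the line m and the hypersurface f = 0
   (equivalently, of m and the plane curve cut out by f in a plane containing
   m): the order of vanishing at P of the restriction of f to m, where None
   stands for infinity.  Any point of m other than P may replace the one
   selected by vpick. *)
Definition inter_mult (m : {vspace vec}) (f : form) (P : vec) : option nat :=
  if P \in m then
    let q := restrict_to_line f P (vpick (m :\: <[P]>)%VS) in
    if q == 0 then None else Some (mup 0 q)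
  else Some 0%N.

Definition enat_ge (k : nat) (e : option nat) : Prop :=
  if e is Some n then (k <= n)%N else True.

(* The family of lines sweeping out the surface S_8. *)
Definition S_lines (X : form) (ell m : {vspace vec}) : Prop :=
  is_line m /\
  exists2 P : vec, P != 0 /\ P \in ell &
    (forall v, v \in m -> vanishes (tangent_form X P) v) /\
    exists2 C : form, residual_cubic X ell P C & enat_ge 2 (inter_mult m C P).

(* The point set of the surface S_8 defined by (X, ell). *)
Definition S8 (X : form) (ell : {vspace vec}) (v : vec) : Prop :=
  exists2 m, S_lines X ell m & v \in m.

(* The surface S = 0 is a union of lines, each of which meets ell. *)
Definition union_of_lines_meeting (S : form) (ell : {vspace vec}) : Prop :=
  exists Fam : {vspace vec} -> Prop,
    (forall m, Fam m -> is_line m /\ (m :&: ell)%VS != 0%VS) /\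
    (forall v, v != 0 -> (vanishes S v <-> exists2 m, Fam m & v \in m)).

(* X is given by an equation S + L_1 L_2 L_3 L_4 = 0 as in Segre's
   construction; planes of the pencil through ell may be repeated. *)
Definition segre_construction (X : form) (ell : {vspace vec}) : Prop :=
  exists (S : form) (L : 'I_4 -> form),
    [/\ is_form 4 S,
        union_of_lines_meeting S ell,
        forall i, is_form 1 (L i) /\ (forall v, v \in ell -> vanishes (L i) v)
      & forall v, vanishes X v <-> vanishes (S + \prod_(i < 4) L i) v].

(* S_8 is the union of three distinct planes and an irreducible quintic. *)
Definition three_planes_and_quintic (Z : vec -> Prop) : Prop :=
  exists (H1 H2 H3 : {vspace vec}) (Q : form),
    [/\ is_plane H1, is_plane H2, is_plane H3 & uniq [:: H1; H2; H3]] /\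
    [/\ is_form 5 Q, irreducible_form Q
      & forall v, v != 0 ->
          (Z v <-> [\/ v \in H1, v \in H2, v \in H3 | vanishes Q v])].

Definition binary_quartic (e : 'I_5 -> K) : form :=
  \sum_(i < 5) e i *: ('X_o3 ^+ (4 - i) * 'X_o4 ^+ i).

Definition familyT (a b c : K) (g : form) : form :=
  let x1 : form := 'X_o1 in let x2 : form := 'X_o2 in
  let x3 : form := 'X_o3 in let x4 : form := 'X_o4 in
  let d := b + 4%:R * a * c ^+ 3 in
  g
  - (4%:R * c ^+ 3 * d) *: (x1 * x2 * x4 ^+ 2)
  + b *: (x1 * x2 * x3 * x4)
  + a *: (x1 * x2 * x3 ^+ 2)
  + x2 ^+ 2 * (x2 - (3%:R * c) *: x1) * x4
  + x1 ^+ 3 * x3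
  + (3%:R^-1 * c) *:
      ((x3 - (4%:R * c ^+ 3) *: x4) * (d *: x4 + a *: x3) ^+ 2
         * (c *: x1 + x2)).

(* A point of the ambient affine space K^8 of the parameter space is
   (a, b, c, e_0, ..., e_4), the e_i being the coefficients of g. *)
Definition param_a (p : 'I_8 -> K) : K := p (@Ordinal 8 0 isT).
Definition param_b (p : 'I_8 -> K) : K := p (@Ordinal 8 1 isT).
Definition param_c (p : 'I_8 -> K) : K := p (@Ordinal 8 2 isT).
Definition param_g (p : 'I_8 -> K) : form :=
  binary_quartic (fun i => p (@rshift 3 5 i)).

Definition memberT (p : 'I_8 -> K) : form :=
  familyT (param_a p) (param_b p) (param_c p) (param_g p).

Definition zariski_open n (U : ('I_n -> K) -> Prop) : Prop :=
  exists I : {mpoly K[n]} -> Prop,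
    forall p, U p <-> exists2 f, I f & f.@[p] != 0.

(* The property Phi holds on a nonempty open subset of the parameter space
   {c != 0}. *)
Definition for_general_T (Phi : form -> Prop) : Prop :=
  exists U : ('I_8 -> K) -> Prop,
    [/\ zariski_open U,
        exists2 p, U p & param_c p != 0
      & forall p, U p -> param_c p != 0 -> Phi (memberT p)].

End ProjectiveSpace.

Arguments line34 {K}.

(* Main.v *)
Require Import Defs.
From mathcomp Require Import all_boot all_order all_algebra.
From mathcomp Require Import separable.
From mathcomp Require Import ring.
Local Open Scope ring_scope.

(** Write M = x_3 - 4 c^3 x_4 and N = a x_3 + d x_4 with d = b + 4 a c^3.  The
    quadratic part of a member X of the family in (x_3, x_4) is x_1 x_2 M N, so
      X = x_1^3 x_3 + x_2^2 (x_2 - 3 c x_1) x_4 + x_1 x_2 M N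
          + (c/3) M N^2 (c x_1 + x_2) + g.
    At P = (s : t : 0 : 0) the tangent plane of X is
      s^3 x_3 + t^2 (t - 3 c s) x_4 = 0   (the form tangency),
    and a line of this plane through P and v off ell meets the residual cubic
    F_P with multiplicity at least 2 iff it meets X with multiplicity at least 3,
    because the equation of ell in the plane accounts for one more zero.  This
    is the vanishing of the z^2 coefficient of X(P + z v), the form inflection.

    Part (b).  On the tangent plane put v_3 = t^2 (t - 3 c s) u, v_4 = - s^3 u.
    As M takes the value (t - 2 c s)^2 (t + c s) u there, inflection factors as
      u s t (t - 2 c s) q(s, t),
    where q is a quadratic form in (s, t) with coefficients linear in v
    (inflection_factor).  The points with s = 0, t = 0 and t = 2 c s sweep out
    the planes x_4 = 0, x_3 = 0 and M = 0.  The rest of S_8 is the locus where q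
    and the cubic tangency have a common root, i.e. where their resultant
    vanishes: it has degree 3 in the coefficients of q and 2 in those of
    tangency, hence is a quintic.  Its part of highest degree in (x_1, x_2) is
      - 27 x_4 (x_1^3 x_3 + x_2^2 (x_2 - 3 c x_1) x_4).
    The cubic factor is linear in x_3 with coprime coefficients, hence
    irreducible, so in any factorization of the quintic one factor has leading
    part dividing x_4, and then is itself constant or a multiple of x_4; but x_4
    does not divide the quintic when a <> 0 (quintic_irreducible).

    Part (a).  Suppose X is also given by Y = S + H with H the product of the
    four planes.  For general parameters some line meets X in four distinct
    points, and this forces Y to be a multiple of X (proportional_forms):
    S = k X - H, where H is a form in x_3, x_4 only.  So S has the same terms of
    order at most 3 along ell as k X.  A line of S through P in ell lies in
    tangency = inflection = 0, and when s t (t - 2 c s) <> 0 the equation q = 0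
    makes the z^3 coefficient vanish as well and gives
      27 v_4 (X - g)(v) = M(v)^2 N(v)^3   (osculating_value).
    With S(v) = 0 this is a relation between v_3 and v_4 alone, of degree 5
    with leading term k a^3 v_3^5.  It fails for all but finitely many planes
    through ell, although S has points in each of them. *)

Set Implicit Arguments.
Unset Strict Implicit.
Unset Printing Implicit Defensive.

Import GRing.Theory.

(** * Forms and the decomposition of the family *)

Section Homogeneity.

Variables (n : nat) (R : comNzRingType).
Implicit Types p q : {mpoly R[n]}.

Lemma homog_var i : ('X_i : {mpoly R[n]}) \is 1.-homog.
Proof. by rewrite dhomogX /= mdeg1. Qed.

Lemma homog_const (c : R) : (c%:MP : {mpoly R[n]}) \is 0.-homog.
Proof. by rewrite -[c%:MP]mulr1 mul_mpolyC dhomogZ // dhomog1. Qed.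

Lemma homog_nat (k : nat) : (k%:R : {mpoly R[n]}) \is 0.-homog.
Proof. by rewrite -mpolyC_nat; apply: homog_const. Qed.

Lemma homog_mul d e k p q :
  p \is d.-homog -> q \is e.-homog -> (d + e)%N = k -> p * q \is k.-homog.
Proof. by move=> hp hq <-; apply: dhomogM. Qed.

Lemma homog_exp d m k p :
  p \is d.-homog -> (d * m)%N = k -> p ^+ m \is k.-homog.
Proof. by move=> hp <-; apply: dhomogMn. Qed.

End Homogeneity.

(** The degree of a factor is an existential variable that the leaves of the
    factor instantiate, so that only the total degree is ever given. *)
Ltac solve_homog :=
  lazymatch goal with
  | |- is_true ((_ + _) \in _) => apply: dhomogD; solve_homog
  | |- is_true ((- _) \in _) => rewrite dhomogN; solve_homog
  | |- is_true ((_ *: _) \in _) => apply: dhomogZ; solve_homog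
  | |- is_true ((_ * _) \in _) =>
      eapply homog_mul; [solve_homog | solve_homog | reflexivity]
  | |- is_true ((_ ^+ _) \in _) => eapply homog_exp; [solve_homog | reflexivity]
  | |- is_true (_%:MP \in _) => apply: homog_const
  | |- is_true (_%:R \in _) => apply: homog_nat
  | _ => apply: homog_var
  end.

Section Family.

Variables (K : closedFieldType) (a b c : K) (e : 'I_5 -> K).

Notation vec := 'rV[K]_4.
Notation form := {mpoly K[4]}.

Let d := b + 4%:R * a * c ^+ 3.
Let k := 3%:R^-1 * c.
Let E i := e (inord i).

(** The cofactors of x_3 and x_4 in a decomposition X = x_3 A + x_4 B.  The
    residual cubics at all points of ell are combinations of these two. *)
Definition cofactor3 : form :=
  let x1 : form := 'X_o1 in let x2 : form := 'X_o2 in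
  let x3 : form := 'X_o3 in let x4 : form := 'X_o4 in
  let N := a *: x3 + d *: x4 in
  x1 ^+ 3 + x1 * x2 * N + k *: (N ^+ 2 * (c *: x1 + x2))
  + (E 0 *: x3 ^+ 3 + E 1 *: (x3 ^+ 2 * x4) + E 2 *: (x3 * x4 ^+ 2)
     + E 3 *: x4 ^+ 3).

Definition cofactor4 : form :=
  let x1 : form := 'X_o1 in let x2 : form := 'X_o2 in
  let x3 : form := 'X_o3 in let x4 : form := 'X_o4 in
  let N := a *: x3 + d *: x4 in
  x2 ^+ 2 * (x2 - (3%:R * c) *: x1)
  - (4%:R * c ^+ 3) *: (x1 * x2 * N + k *: (N ^+ 2 * (c *: x1 + x2)))
  + E 4 *: x4 ^+ 3.

Lemma binary_quarticE :
  binary_quartic e =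
    'X_o3 * (E 0 *: 'X_o3 ^+ 3 + E 1 *: ('X_o3 ^+ 2 * 'X_o4)
             + E 2 *: ('X_o3 * 'X_o4 ^+ 2) + E 3 *: 'X_o4 ^+ 3)
    + 'X_o4 * (E 4 *: 'X_o4 ^+ 3).
Proof.
rewrite /binary_quartic !big_ord_recl big_ord0 /=.
have eE i (j : 'I_5) : val j = i -> e j = E i.
  by move=> <-; rewrite /E inord_val.
rewrite (eE 0%N) // (eE 1%N) // (eE 2%N) // (eE 3%N) // (eE 4%N) //.
rewrite -!mul_mpolyC; ring.
Qed.

Lemma familyT_split :
  familyT a b c (binary_quartic e) = 'X_o3 * cofactor3 + 'X_o4 * cofactor4.
Proof.
rewrite binary_quarticE /familyT /cofactor3 /cofactor4 -/d -/k.
have -> : b = d - 4%:R * a * c ^+ 3 by rewrite /d addrK.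
move: k d => k' d'; rewrite -!mul_mpolyC; ring.
Qed.

Lemma cofactor3_homog : cofactor3 \is 3.-homog.
Proof. by rewrite /cofactor3; solve_homog. Qed.

Lemma cofactor4_homog : cofactor4 \is 3.-homog.
Proof. by rewrite /cofactor4; solve_homog. Qed.

End Family.

(** * Restriction to lines, tangent planes and residual cubics *)

Section TopCoefficient.

Variable R : comNzRingType.

Lemma coef_top_mul (p q : {poly R}) (m n : nat) :
  (size p <= m.+1)%N -> (size q <= n.+1)%N ->
  (size (p * q)%R <= (m + n).+1)%N /\ (p * q)`_(m + n) = p`_m * q`_n.
Proof.
move=> sp sq; split.
  rewrite (leq_trans (size_polyMleq _ _)) //.
  case: (size p) sp => [|sp'] sp /=; last by rewrite -addnS leq_add.
  by rewrite (leq_trans (leq_pred _)) // (leq_trans sq) // ltnS leq_addl.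
rewrite coefM; have lt_m : (m < (m + n).+1)%N by rewrite ltnS leq_addr.
rewrite (bigD1 (Ordinal lt_m)) //= addKn big1 ?addr0 // => i nim.
have [lim|lmi] := ltnP i m.
  rewrite [q`__]nth_default ?mulr0 // (leq_trans sq) // ltn_subRL.
  by rewrite ltn_add2r.
rewrite [p`__]nth_default ?mul0r // (leq_trans sp) // ltn_neqAle lmi andbT.
by rewrite eq_sym -(inj_eq val_inj) in nim *.
Qed.

Lemma size_prod_linear (I : Type) (r : seq I) (p q : I -> R) (w : I -> nat) :
  let F := \prod_(i <- r) ((p i)%:P + q i *: 'X) ^+ w i in
  (size F <= (\sum_(i <- r) w i).+1)%N /\
  F`_(\sum_(i <- r) w i) = \prod_(i <- r) q i ^+ w i.
Proof.
elim: r => [|i r [IH1 IH2]] /=; first by rewrite !big_nil size_poly1 coefC.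
have [s1 c1] : (size (((p i)%:P + q i *: 'X) ^+ w i)%R <= (w i).+1)%N /\
   (((p i)%:P + q i *: 'X) ^+ w i)`_(w i) = q i ^+ w i.
  elim: (w i) => [|k [s1 c1]]; first by rewrite !expr0 size_poly1 coefC.
  rewrite !exprS -c1 -[k.+1]add1n.
  have sl : (size ((p i)%:P + q i *: 'X : {poly R})%R <= 2)%N.
    rewrite (leq_trans (size_polyD _ _)) // geq_max (leq_trans (size_polyC_leq1 _)) //.
    by rewrite (leq_trans (size_scale_leq _ _)) ?size_polyX.
  have [h1 h2] := coef_top_mul sl s1; split=> //.
  by rewrite h2 coefD coefC coefZ coefX /= add0r mulr1.
have [h1 h2] := coef_top_mul s1 IH1.
by rewrite !big_cons -IH2 -c1; split.
Qed.

(** Restricting a form to a line p + q z, over any extension of the constants: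
    the coefficient of z^d is the value at the point q at infinity. *)
Lemma mmap_line_homog (K : nzRingType) n (f : {rmorphism K -> R}) (p q : 'I_n -> R)
    (g : {mpoly K[n]}) d : g \is d.-homog ->
  let F := mmap (polyC \o f) (fun i => (p i)%:P + q i *: 'X) g in
  (size F <= d.+1)%N /\ F`_d = mmap f q g.
Proof.
move=> /dhomogP hg; rewrite /mmap.
have hm m : m \in msupp g -> (\sum_(i < n) m i)%N = d by move=> /hg; rewrite /= mdegE.
split.
  rewrite (leq_trans (size_sum _ _ _)) //; apply/bigmax_leqP_seq => m /hm <- _.
  rewrite mul_polyC (leq_trans (size_scale_leq _ _)) //.
  by have [] := size_prod_linear (index_enum 'I_n) p q m.
rewrite coef_sum; apply: eq_big_seq => m /hm <-.
rewrite coefCM; congr (_ * _).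
by have [] := size_prod_linear (index_enum 'I_n) p q m.
Qed.

End TopCoefficient.

Section Geometry.

Variable K : closedFieldType.

Notation vec := 'rV[K]_4.
Notation form := {mpoly K[4]}.

Implicit Types (f X A B C : form) (P Q v : vec).

Definition on34 P := P 0 o3 = 0 /\ P 0 o4 = 0.

Lemma on34P P : reflect (on34 P) (P \in line34).
Proof.
by rewrite mem_line34; apply: (iffP andP) => -[h3 h4]; split; apply/eqP.
Qed.

Lemma ord4P (j : 'I_4) : [\/ j = o1, j = o2, j = o3 | j = o4].
Proof.
by case: j => [[|[|[|[|j]]]] ltj] //;
  [constructor 1 | constructor 2 | constructor 3 | constructor 4];
  apply: val_inj.
Qed.

Lemma evalv_var i v : evalv 'X_i v = v 0 i.
Proof. exact: mevalXU. Qed.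

Lemma evalvD f g v : evalv (f + g) v = evalv f v + evalv g v.
Proof. exact: mevalD. Qed.
Lemma evalvB f g v : evalv (f - g) v = evalv f v - evalv g v.
Proof. exact: mevalB. Qed.
Lemma evalvN f v : evalv (- f) v = - evalv f v.
Proof. exact: mevalN. Qed.
Lemma evalvM f g v : evalv (f * g) v = evalv f v * evalv g v.
Proof. exact: mevalM. Qed.
Lemma evalvZ (c : K) f v : evalv (c *: f) v = c * evalv f v.
Proof. exact: mevalZ. Qed.
Lemma evalvX f n v : evalv (f ^+ n) v = evalv f v ^+ n.
Proof. exact: rmorphXn. Qed.
Definition evalvE := (evalvD, evalvB, evalvN, evalvM, evalvZ, evalvX, evalv_var).

Lemma restrD f g P Q :
  restrict_to_line (f + g) P Q = restrict_to_line f P Q + restrict_to_line g P Q.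
Proof. exact: mmapD. Qed.
Lemma restrB f g P Q :
  restrict_to_line (f - g) P Q = restrict_to_line f P Q - restrict_to_line g P Q.
Proof. exact: mmapB. Qed.
Lemma restrN f P Q : restrict_to_line (- f) P Q = - restrict_to_line f P Q.
Proof. exact: mmapN. Qed.
Lemma restrM f g P Q :
  restrict_to_line (f * g) P Q = restrict_to_line f P Q * restrict_to_line g P Q.
Proof. exact: rmorphM. Qed.
Lemma restrZ (c : K) f P Q :
  restrict_to_line (c *: f) P Q = c%:P * restrict_to_line f P Q.
Proof. exact: mmapZ. Qed.
Lemma restrX f n P Q : restrict_to_line (f ^+ n) P Q = restrict_to_line f P Q ^+ n.
Proof. exact: rmorphXn. Qed.
Lemma restr_var i P Q :
  restrict_to_line 'X_i P Q = (P 0 i)%:P + (Q 0 i)%:P * 'X.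
Proof. by rewrite /restrict_to_line mmapX mmap1U mul_polyC. Qed.
Definition restrE := (restrD, restrB, restrN, restrM, restrZ, restrX, restr_var).

Lemma horner_restr f P Q z : (restrict_to_line f P Q).[z] = evalv f (P + z *: Q).
Proof.
rewrite /restrict_to_line /evalv /mmap mevalE horner_sum; apply: eq_bigr => m _.
rewrite hornerM hornerC; congr (_ * _).
rewrite /mmap1 horner_prod; apply: eq_bigr => i _.
by rewrite horner_exp !hornerE !mxE mulrC.
Qed.

Lemma restr_homog f d P Q : f \is d.-homog ->
  (size (restrict_to_line f P Q) <= d.+1)%N /\
  (restrict_to_line f P Q)`_d = evalv f Q.
Proof.
move=> hf; have := @mmap_line_homog K K 4 idfun (fun i => P 0 i) (fun i => Q 0 i) f d hf.
exact.
Qed.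

Lemma restr_linear f P Q : f \is 1.-homog ->
  restrict_to_line f P Q = (evalv f P)%:P + (evalv f Q)%:P * 'X.
Proof.
move=> /(restr_homog P Q)[sz c1].
have c0 : (restrict_to_line f P Q)`_0 = evalv f P.
  by rewrite -horner_coef0 horner_restr scale0r addr0.
apply/polyP => -[|[|i]]; rewrite coefD coefC coefCM coefX /=;
  rewrite ?mulr1 ?mulr0 ?addr0 ?add0r //.
by rewrite nth_default // (leq_trans sz).
Qed.

(** In the derivatives of x_3 A + x_4 B at a point of ell, the terms with a factor
    x_3 or x_4 drop out. *)
Lemma tangent_form_pencil A B P : on34 P ->
  tangent_form ('X_o3 * A + 'X_o4 * B) P = evalv A P *: 'X_o3 + evalv B P *: 'X_o4.
Proof.
move=> [P3 P4]; rewrite /tangent_form.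
have derE i : evalv ('X_o3 * A + 'X_o4 * B)^`M(i) P
    = (i == o3)%:R * evalv A P + (i == o4)%:R * evalv B P.
  have dX j : evalv ('X_j : form)^`M(i) P = (i == j)%:R.
    rewrite mderivX mnm1E evalvZ [j == i]eq_sym.
    have [->|_] := eqVneq i j; last by rewrite mul0r.
    have -> : (U_(j) - U_(j) = 0 :> 'X_{1..4})%MM.
      by apply/mnmP => l; rewrite mnmBE subnn mnm0E.
    by rewrite /evalv mpolyX0 meval1 mulr1.
  by rewrite mderivD !mderivM !evalvE P3 P4 !mul0r !addr0 !dX.
rewrite (bigD1 o3) //= (bigD1 o4) //= big1 ?addr0 => [|i /andP[n3 n4]].
  by rewrite !derE !eqxx /= !mul1r !mul0r addr0 add0r.
by rewrite derE (negbTE n3) (negbTE n4) !mul0r addr0 scale0r.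
Qed.

(** If A(P) <> 0, the tangent plane expresses x_3 as a multiple of x_4, so x_4 is
    an equation of ell in it; if B(P) <> 0, symmetrically with x_3. *)
Lemma residual_cubic_exists A B P : A \is 3.-homog -> B \is 3.-homog ->
  on34 P -> (evalv A P != 0) || (evalv B P != 0) ->
  exists C, residual_cubic ('X_o3 * A + 'X_o4 * B) line34 P C.
Proof.
move=> hA hB PL; rewrite /residual_cubic tangent_form_pencil //.
set al := evalv A P; set be := evalv B P.
case/orP => n0.
  exists (B - (be / al) *: A); split.
    by rewrite dhomogD ?dhomogN ?dhomogZ.
  exists 'X_o4, (al^-1 *: A); split; first exact: homog_var.
    move=> v; rewrite mem_line34 /vanishes !evalvE; split.
      by case/andP=> /eqP-> /eqP->; rewrite !mulr0 addr0.
    case=> /[swap] -> /eqP; rewrite mulr0 addr0 mulf_eq0 (negbTE n0) /= => ->.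
    by rewrite eqxx.
  have -> : 'X_o3 * A = al *: 'X_o3 * (al^-1 *: A) :> form.
    by rewrite -scalerAl -scalerAr scalerA divff ?scale1r.
  rewrite -!mul_mpolyC mpolyCM; ring.
exists (A - (al / be) *: B); split.
  by rewrite dhomogD ?dhomogN ?dhomogZ.
exists 'X_o3, (be^-1 *: B); split; first exact: homog_var.
  move=> v; rewrite mem_line34 /vanishes !evalvE; split.
    by case/andP=> /eqP-> /eqP->; rewrite !mulr0 addr0.
  case=> /[swap] -> /eqP; rewrite mulr0 add0r mulf_eq0 (negbTE n0) /= => ->.
  by rewrite eqxx.
have -> : 'X_o4 * B = be *: 'X_o4 * (be^-1 *: B) :> form.
  by rewrite -scalerAl -scalerAr scalerA divff ?scale1r.
rewrite -!mul_mpolyC mpolyCM; ring.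
Qed.

Lemma inter_mult_ge2 (m : {vspace vec}) C P Q : P \in m -> Q = vpick (m :\: <[P]>)%VS ->
  (enat_ge 2 (inter_mult m C P)) <-> 'X ^+ 2 %| restrict_to_line C P Q.
Proof.
move=> Pm ->; rewrite /inter_mult Pm; set q := restrict_to_line _ _ _.
have [->|q0] := eqVneq q 0; first by rewrite dvdp0.
by rewrite /= mup_geq // subr0.
Qed.

(** The equation of ell in the tangent plane vanishes once at P along any other
    line of the plane, so contact 2 with F_P is contact 3 with X. *)
Lemma residual_order A B P Q C : on34 P ->
  evalv A P * Q 0 o3 + evalv B P * Q 0 o4 = 0 -> ~~ (Q \in line34) ->
  residual_cubic ('X_o3 * A + 'X_o4 * B) line34 P C ->
  ('X ^+ 2 %| restrict_to_line C P Q)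
    = ('X ^+ 3 %| restrict_to_line ('X_o3 * A + 'X_o4 * B) P Q).
Proof.
move=> PL TQ QL [_ [lam [D [hlam ellP ->]]]].
have [P3 P4] := PL.
have Tv v : vanishes (tangent_form ('X_o3 * A + 'X_o4 * B) P) v
   <-> evalv A P * v 0 o3 + evalv B P * v 0 o4 = 0.
  by rewrite /vanishes tangent_form_pencil // !evalvE.
(* On a line inside the tangent plane, only lam * C survives, and lam restricts
   to a nonzero multiple of the parameter. *)
rewrite restrD !restrM [restrict_to_line (tangent_form _ _) _ _](_ : _ = 0); last first.
  rewrite tangent_form_pencil // !restrE P3 P4 !add0r !mulrA -!polyCM -mulrDl.
  by rewrite -polyCD TQ mul0r.
rewrite mul0r addr0.
have lP : evalv lam P = 0 by have /ellP[] : P \in line34 by apply/on34P.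
have -> : restrict_to_line lam P Q = (evalv lam Q)%:P * 'X.
  by rewrite restr_linear // lP add0r.
have lQ : evalv lam Q != 0.
  apply: contra QL => /eqP lQ; apply/ellP; split=> //; exact/Tv.
by rewrite -mulrA mul_polyC dvdpZr // exprS dvdp_mul2l // polyX_eq0.
Qed.

End Geometry.

(** * Expansion of the quartic along the line *)

Section Expansion.

Variables (K : closedFieldType) (a b c : K) (e : 'I_5 -> K).

Notation vec := 'rV[K]_4.
Notation form := {mpoly K[4]}.

Implicit Types (P Q v : vec) (s t : K).

Local Notation X := (familyT a b c (binary_quartic e)).
Local Notation d := (b + 4%:R * a * c ^+ 3).

(** The quadratic part of X in (x_3, x_4) is x_1 x_2 times formM times formN. *)
Definition formM v := v 0 o3 - 4%:R * c ^+ 3 * v 0 o4.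
Definition formN v := a * v 0 o3 + d * v 0 o4.

(** The coefficients of z, z^2 and z^3 in X(P + z v), where P = (s, t, 0, 0), are
    tangency, inflection and cubic_term. *)
Definition tangency s t v := s ^+ 3 * v 0 o3 + t ^+ 2 * (t - 3%:R * c * s) * v 0 o4.

Definition inflection s t v :=
  3%:R * s ^+ 2 * v 0 o1 * v 0 o3
  + v 0 o4 * (3%:R * t ^+ 2 * v 0 o2 - 3%:R * c * t ^+ 2 * v 0 o1
              - 6%:R * c * s * t * v 0 o2)
  + s * t * formM v * formN v.

Definition cubic_term s t v :=
  3%:R * s * v 0 o1 ^+ 2 * v 0 o3
  + v 0 o4 * (3%:R * t * v 0 o2 ^+ 2
              - 3%:R * c * (s * v 0 o2 ^+ 2 + 2%:R * t * v 0 o1 * v 0 o2))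
  + formM v * formN v * (s * v 0 o2 + t * v 0 o1)
  + 3%:R^-1 * c * formM v * formN v ^+ 2 * (c * s + t).

Definition binq (x y : K) :=
  e (inord 0) * x ^+ 4 + e (inord 1) * (x ^+ 3 * y) + e (inord 2) * (x ^+ 2 * y ^+ 2)
  + e (inord 3) * (x * y ^+ 3) + e (inord 4) * y ^+ 4.

Lemma evalv_family v : evalv X v =
  binq (v 0 o3) (v 0 o4) + v 0 o1 * v 0 o2 * formM v * formN v
  + v 0 o2 ^+ 2 * (v 0 o2 - 3%:R * c * v 0 o1) * v 0 o4 + v 0 o1 ^+ 3 * v 0 o3
  + 3%:R^-1 * c * formM v * formN v ^+ 2 * (c * v 0 o1 + v 0 o2).
Proof.
rewrite binary_quarticE /familyT !evalvE /binq /formM /formN.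
move: 3%:R^-1 (e _) (e _) (e _) (e _) (e _) => k e0 e1 e2 e3 e4.
move: (v 0 o1) (v 0 o2) (v 0 o3) (v 0 o4) => x1 x2 x3 x4. ring.
Qed.

Lemma restr_family P Q : on34 P ->
  restrict_to_line X P Q =
    (tangency (P 0 o1) (P 0 o2) Q)%:P * 'X + (inflection (P 0 o1) (P 0 o2) Q)%:P * 'X ^+ 2
    + 'X ^+ 3 * ((cubic_term (P 0 o1) (P 0 o2) Q)%:P + (evalv X Q)%:P * 'X).
Proof.
move=> [P3 P4]; rewrite evalv_family binary_quarticE /familyT !restrE P3 P4.
rewrite /tangency /inflection /cubic_term /binq /formM /formN.
move: 3%:R^-1 (e _) (e _) (e _) (e _) (e _) => k e0 e1 e2 e3 e4.
move: (P 0 o1) (P 0 o2) (Q 0 o1) (Q 0 o2) (Q 0 o3) (Q 0 o4) => s t x1 x2 x3 x4.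
ring.
Qed.

Lemma order3_family P Q : on34 P ->
  ('X ^+ 3 %| restrict_to_line X P Q) =
  (tangency (P 0 o1) (P 0 o2) Q == 0) && (inflection (P 0 o1) (P 0 o2) Q == 0).
Proof.
move=> /restr_family ->; rewrite dvdp_addl ?dvdp_mulIl //.
set T := tangency _ _ _; set E := inflection _ _ _.
apply/idP/andP => [/dvdpP[q def_q]|[/eqP-> /eqP->]]; last first.
  by rewrite !mul0r addr0 dvdp0.
have cf i : (i < 3)%N -> (q * 'X ^+ 3)`_i = 0 by move=> i3; rewrite coefMXn i3.
have := cf 1%N isT; have := cf 2%N isT.
rewrite -def_q !coefD !coefCM !coefX !coefXn /= !mulr0 !mulr1 addr0 add0r.
by move=> -> ->.
Qed.

(** On the tangent plane, inflection depends only on the line joining P to v, up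
    to a square factor. *)
Lemma inflection_shift P v k j : on34 P -> tangency (P 0 o1) (P 0 o2) v = 0 ->
  inflection (P 0 o1) (P 0 o2) (k *: v + j *: P)
    = k ^+ 2 * inflection (P 0 o1) (P 0 o2) v.
Proof.
move=> [P3 P4] Tv; pose D := 3%:R * k * j * tangency (P 0 o1) (P 0 o2) v.
rewrite -[RHS]addr0 -(_ : D = 0) /D; last by rewrite Tv mulr0.
rewrite /inflection /tangency /formM /formN !mxE P3 P4; ring.
Qed.

End Expansion.

(** * The lines sweeping out the surface *)

Section Subspaces.

Variables (K : fieldType) (V : vectType K).
Implicit Types (U m : {vspace V}) (u v : V).

Lemma dim_addv_line U v : v \notin U -> \dim (U + <[v]>)%VS = (\dim U).+1.
Proof.
move=> vU; have v0 : v != 0 by apply: contraNneq vU => ->; exact: mem0v.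
rewrite dimv_disjoint_sum ?dim_vline ?v0 ?addn1 //.
apply/eqP; rewrite -subv0; apply/subvP => w; rewrite memv_cap.
move=> /andP[wU /vlineP[k def_w]].
rewrite memv0; apply: contraNT vU => w0; have k0 : k != 0.
  by apply: contraNneq w0 => k0; rewrite def_w k0 scale0r.
by rewrite -[v](scalerK k0) -def_w memvZ.
Qed.

Lemma line_spanned m u v : \dim m = 2 -> u != 0 -> v \notin <[u]>%VS ->
  u \in m -> v \in m -> m = (<[u]> + <[v]>)%VS.
Proof.
move=> dm u0 vu um vm; apply/esym/eqP; rewrite eqEdim dm dim_addv_line // dim_vline u0.
by rewrite andbT subv_add -!memvE um vm.
Qed.

(** The second point by which a line is parametrized in an intersection
    multiplicity. *)
Lemma vpick_diff m u : \dim m = 2 ->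
  let w := vpick (m :\: <[u]>)%VS in w \in m /\ w \notin <[u]>%VS.
Proof.
move=> dm w; have wd : w \in (m :\: <[u]>)%VS by apply: memv_pick.
have wm : w \in m by apply: subvP wd; apply: diffvSl.
split=> //; apply/negP => wu.
have /eqP : w = 0.
  by apply/eqP; rewrite -memv0 -(capv_diff m <[u]>) memv_cap wd wu.
rewrite vpick0 => /eqP d0; have := dimv_cap_compl m <[u]>%VS.
rewrite d0 dimv0 addn0 dm => dc.
by have := dimvS (capvSr m <[u]>); rewrite dc dim_vline; case: (u != 0).
Qed.

End Subspaces.

Section S8family.

Variables (K : closedFieldType) (a b c : K) (e : 'I_5 -> K).

Notation vec := 'rV[K]_4.
Notation form := {mpoly K[4]}.

Implicit Types (P Q v : vec) (s t : K).

Local Notation X := (familyT a b c (binary_quartic e)).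
Local Notation A := (cofactor3 a b c e).
Local Notation B := (cofactor4 a b c e).

Lemma cofactor3_on34 P : on34 P -> evalv A P = P 0 o1 ^+ 3.
Proof. by case=> P3 P4; rewrite /cofactor3 !evalvE P3 P4; ring. Qed.

Lemma cofactor4_on34 P : on34 P ->
  evalv B P = P 0 o2 ^+ 2 * (P 0 o2 - 3%:R * c * P 0 o1).
Proof. by case=> P3 P4; rewrite /cofactor4 !evalvE P3 P4; ring. Qed.

Lemma on34_neq0 P : on34 P -> P != 0 -> (P 0 o1 != 0) || (P 0 o2 != 0).
Proof.
move=> [P3 P4]; apply: contraNT; rewrite negb_or !negbK => /andP[/eqP P1 /eqP P2].
by apply/eqP/rowP => j; rewrite mxE; case: (ord4P j) => ->.
Qed.

Lemma tangency_form P v : on34 P ->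
  evalv (tangent_form X P) v = tangency c (P 0 o1) (P 0 o2) v.
Proof.
move=> PL; rewrite familyT_split tangent_form_pencil // cofactor3_on34 // cofactor4_on34 //.
by rewrite !evalvE.
Qed.

(** X is smooth along ell: its gradient there is (0, 0, s^3, t^2 (t - 3 c s)). *)
Lemma smooth_on34 P : on34 P -> P != 0 -> (evalv A P != 0) || (evalv B P != 0).
Proof.
move=> PL P0; rewrite cofactor3_on34 // cofactor4_on34 //.
have [P1|P1] := eqVneq (P 0 o1) 0; last by rewrite expf_neq0.
have /orP[/eqP//|P2] := on34_neq0 PL P0.
by rewrite P1 mulr0 subr0 orbC -exprSr expf_neq0.
Qed.

Definition pt34 s t : vec := s *: delta_mx 0 o1 + t *: delta_mx 0 o2.

Lemma pt34E s t : [/\ pt34 s t 0 o1 = s, pt34 s t 0 o2 = t & on34 (pt34 s t)].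
Proof. by rewrite /on34 !mxE /= !mulr0 !mulr1 !addr0 add0r. Qed.

Lemma tangency_comb P v j k : on34 P ->
  tangency c (P 0 o1) (P 0 o2) (j *: P + k *: v) = k * tangency c (P 0 o1) (P 0 o2) v.
Proof. by case=> P3 P4; rewrite /tangency !mxE P3 P4; ring. Qed.

Lemma residual_mult_ge2 (m : {vspace vec}) P v C : on34 P -> P != 0 -> v \notin line34 ->
  \dim m = 2 -> P \in m -> v \in m -> tangency c (P 0 o1) (P 0 o2) v = 0 ->
  residual_cubic X line34 P C ->
  enat_ge 2 (inter_mult m C P) <-> inflection a b c (P 0 o1) (P 0 o2) v = 0.
Proof.
move=> PL P0 vL dm Pm vm Tv; rewrite familyT_split => resC.
have vP : v \notin <[P]>%VS.
  by apply: contra vL => /vlineP[k ->]; rewrite memvZ //; apply/on34P.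
rewrite (inter_mult_ge2 C Pm (erefl _)).
have [] := vpick_diff P dm; set Q := vpick _ => Qm QP.
have := Qm; rewrite (line_spanned dm P0 vP Pm vm).
move=> /memv_addP[_ /vlineP[j ->] [_ /vlineP[k ->] defQ]].
have k0 : k != 0.
  by apply: contraNneq QP => k0; rewrite defQ k0 scale0r addr0 memvZ ?memv_line.
have QL : Q \notin line34.
  apply: contra vL => QL; rewrite -[v](scalerK k0) memvZ //.
  have -> : k *: v = Q - j *: P by rewrite defQ addrC addKr.
  by rewrite rpredB // memvZ //; apply/on34P.
have TQ : tangency c (P 0 o1) (P 0 o2) Q = 0 by rewrite defQ tangency_comb // Tv mulr0.
have TQ' : evalv A P * Q 0 o3 + evalv B P * Q 0 o4 = 0.
  by rewrite cofactor3_on34 // cofactor4_on34.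
rewrite (residual_order PL TQ' QL resC) -familyT_split order3_family // TQ eqxx /=.
rewrite defQ addrC inflection_shift // mulf_eq0 sqrf_eq0 (negbTE k0) /=.
by split=> [/eqP | ->].
Qed.

Lemma S_lines_span P v : on34 P -> P != 0 -> v \notin line34 ->
  tangency c (P 0 o1) (P 0 o2) v = 0 -> inflection a b c (P 0 o1) (P 0 o2) v = 0 ->
  S_lines X line34 (<[P]> + <[v]>)%VS.
Proof.
move=> PL P0 vL Tv Ev; have PL' : P \in line34 by apply/on34P.
have vP : v \notin <[P]>%VS.
  by apply: contra vL => /vlineP[k ->]; rewrite memvZ.
pose m := (<[P]> + <[v]>)%VS.
have Pm : P \in m by rewrite (subvP (addvSl _ _)) ?memv_line.
have vm : v \in m by rewrite (subvP (addvSr _ _)) ?memv_line.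
have dm : \dim m = 2 by rewrite dim_addv_line // dim_vline P0.
split=> //; exists P => //; split=> [w|].
  move=> /memv_addP[_ /vlineP[j ->] [_ /vlineP[k ->] ->]].
  by rewrite /vanishes tangency_form // tangency_comb // Tv mulr0.
have [C] := residual_cubic_exists (cofactor3_homog a b c e) (cofactor4_homog a b c e) PL
  (smooth_on34 PL P0).
rewrite -familyT_split => resC; exists C => //.
by apply/(residual_mult_ge2 PL P0 vL dm Pm vm Tv resC).
Qed.

Lemma S8_off_line v : v \notin line34 ->
  S8 X line34 v <-> exists s t, [/\ (s != 0) || (t != 0),
    tangency c s t v = 0 & inflection a b c s t v = 0].
Proof.
move=> vL; split.
  move=> [m [dm [P [P0 /on34P PL] [Tm [C resC ge2]]]] vm].
  exists (P 0 o1), (P 0 o2); rewrite on34_neq0 //.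
  have Pm : P \in m by move: ge2; rewrite /inter_mult; case: (P \in m).
  have Tv : tangency c (P 0 o1) (P 0 o2) v = 0 by rewrite -tangency_form //; apply: Tm.
  by split=> //; apply/(residual_mult_ge2 PL P0 vL dm Pm vm Tv resC).
move=> [s [t [st]]]; have [Ps Pt PL] := pt34E s t.
have P0 : pt34 s t != 0.
  by apply: contraTneq st => P0; move: Ps Pt; rewrite P0 !mxE => <- <-; rewrite eqxx.
move: (pt34 s t) Ps Pt PL P0 => P <- <- {s t st} PL P0 Tv Ev.
exists (<[P]> + <[v]>)%VS; first exact: S_lines_span.
by rewrite (subvP (addvSr _ _)) ?memv_line.
Qed.

End S8family.

(** * A resultant and the planes of a pencil *)

(** The resultant, with respect to (s : t), of the quadratic form
    p t^2 + q s t + r s^2 and the cubic form D t^3 - 3 c D s t^2 + F s^3.  It is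
    taken over an arbitrary ring, since it is needed for values, for quaternary
    forms and for polynomials over them. *)
Definition resultant23 (R : comNzRingType) (c p q r D F : R) : R :=
  D ^+ 2 * r ^+ 2 * (r + 3%:R * c * q + 9%:R * c ^+ 2 * p)
  + F * D * (- q ^+ 3 + 3%:R * q * r * p - 3%:R * c * p * q ^+ 2
             + 6%:R * c * r * p ^+ 2)
  + F ^+ 2 * p ^+ 3.

Lemma rmorph_resultant23 (R S : comNzRingType) (f : {rmorphism R -> S}) c p q r D F :
  f (resultant23 c p q r D F) = resultant23 (f c) (f p) (f q) (f r) (f D) (f F).
Proof.
by rewrite /resultant23 !(rmorphD, rmorphN, rmorphM, rmorphXn, rmorph_nat, rmorph1).
Qed.

Section ClosedField.

Variable K : closedFieldType.

Lemma closed_root (k : K) (cs : seq K) : k != 0 -> (0 < size cs)%N ->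
  exists z, k * z ^+ size cs + (Poly cs).[z] = 0.
Proof.
move=> k0 cs0; have size_p : size (k *: 'X^(size cs) + Poly cs) = (size cs).+1.
  by rewrite size_polyDl size_scale ?size_polyXn // ltnS size_Poly.
have /closed_rootP[z /rootP pz] : size (k *: 'X^(size cs) + Poly cs) != 1%N.
  by rewrite size_p eqSS -lt0n.
by exists z; rewrite -pz hornerD hornerZ hornerXn.
Qed.

(** For p = 0 one of the factors is s; otherwise divide by t - z s for a root z. *)
Lemma quadratic_factors (p q r : K) : exists l1 m1 l2 m2,
  [/\ p = l1 * l2, q = l1 * m2 + l2 * m1 & r = m1 * m2].
Proof.
have [->|p0] := eqVneq p 0.
  by exists 0, 1, q, r; split; rewrite ?mul0r ?mul1r ?mulr1 ?add0r.
have [//|z] := @closed_root p [:: r; q] p0; rewrite horner_Poly /= => hz.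
exists 1, (- z), p, (q + p * z); split; try by ring.
by rewrite -[LHS]subr0 -hz; ring.
Qed.

(** If the quadratic form is (l1 t + m1 s) (l2 t + m2 s), the resultant is the
    product of the values of the cubic form at (l1, - m1) and (l2, - m2). *)
Lemma resultant23P (c p q r D F : K) :
  (exists s t, [/\ (s != 0) || (t != 0),
     s ^+ 3 * F + t ^+ 2 * (t - 3%:R * c * s) * D = 0
     & p * t ^+ 2 + q * (s * t) + r * s ^+ 2 = 0])
  <-> resultant23 c p q r D F = 0.
Proof.
have [l1 [m1 [l2 [m2 [-> -> ->]]]]] := quadratic_factors p q r.
pose cub s t := s ^+ 3 * F + t ^+ 2 * (t - 3%:R * c * s) * D.
have -> : resultant23 c (l1 * l2) (l1 * m2 + l2 * m1) (m1 * m2) D F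
   = cub l1 (- m1) * cub l2 (- m2) by rewrite /resultant23 /cub; ring.
have quadE s t : l1 * l2 * t ^+ 2 + (l1 * m2 + l2 * m1) * (s * t) + m1 * m2 * s ^+ 2
   = (l1 * t + m1 * s) * (l2 * t + m2 * s) by ring.
split=> [[s [t [st cst /eqP]]]|/eqP].
  have root l m : l * t + m * s = 0 -> cub l (- m) = 0.
    have [s0|s0] := eqVneq s 0.
      move: st cst; rewrite s0 eqxx /= => t0 cst.
      move/eqP; rewrite mulr0 addr0 mulf_eq0 (negbTE t0) orbF => /eqP ->.
      have -> : cub 0 (- m) = - (m / t) ^+ 3 *
         (0 ^+ 3 * F + t ^+ 2 * (t - 3%:R * c * 0) * D) by rewrite /cub; field.
      by rewrite cst mulr0.
    move=> lm; have -> : cub l (- m) = (l / s) ^+ 3 * cub s t.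
      have -> : m = - (l * t) / s.
        by rewrite -[LHS](mulfK s0) -[m * s](addKr (l * t)) lm addr0.
      by rewrite /cub; field.
    by rewrite [cub s t]cst mulr0.
  (* The common root kills one of the two linear factors. *)
  by rewrite quadE mulf_eq0 => /orP[] /eqP /root ->; rewrite ?mul0r ?mulr0.
have cubic_root : exists s t, ((s != 0) || (t != 0)) /\ cub s t = 0.
  have [D0|D0] := eqVneq D 0.
    by exists 0, 1; rewrite oner_eq0 orbT /cub D0; split=> //; ring.
  have [//|t] := @closed_root D [:: F; 0; - (3%:R * c * D)] D0.
  rewrite horner_Poly /= => ht.
  by exists 1, t; rewrite oner_eq0 /cub -[RHS]ht; split=> //; ring.
(* A zero factor l t + m s gives no point of P^1, but then the quadratic form
   vanishes identically and any root of the cubic will do. *)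
rewrite mulf_eq0 => /orP[] /eqP h; [have [lm|lm] := boolP ((l1 != 0) || (- m1 != 0)) |
  have [lm|lm] := boolP ((l2 != 0) || (- m2 != 0))].
- by exists l1, (- m1); split=> //; ring.
- have [s [t [st cst]]] := cubic_root; exists s, t; split=> //.
  by move: lm; rewrite negb_or !negbK oppr_eq0 => /andP[/eqP-> /eqP->]; ring.
- by exists l2, (- m2); split=> //; ring.
have [s [t [st cst]]] := cubic_root; exists s, t; split=> //.
by move: lm; rewrite negb_or !negbK oppr_eq0 => /andP[/eqP-> /eqP->]; ring.
Qed.

End ClosedField.

Section Planes.

Variable K : fieldType.
Notation vec := 'rV[K]_4.
Implicit Types v w : vec.

Definition plane_through w : {vspace vec} := (line34 + <[w]>)%VS.

Lemma plane_throughP w v : w \notin line34 ->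
  v \in plane_through w = (v 0 o3 * w 0 o4 == v 0 o4 * w 0 o3).
Proof.
move=> wL; apply/memv_addP/eqP => [[u uL [_ /vlineP[k ->] ->]]|eqvw].
  move: uL; rewrite mem_line34 => /andP[/eqP u3 /eqP u4].
  by rewrite !mxE u3 u4; ring.
pose k := if w 0 o3 == 0 then v 0 o4 / w 0 o4 else v 0 o3 / w 0 o3.
have [k3 k4] : v 0 o3 = k * w 0 o3 /\ v 0 o4 = k * w 0 o4.
  rewrite /k; have [w3|w3] := eqVneq (w 0 o3) 0.
    have w4 : w 0 o4 != 0 by apply: contra wL => w4; rewrite mem_line34 w3 eqxx.
    rewrite divfK // w3 mulr0; split=> //; move/eqP: eqvw.
    by rewrite w3 mulr0 mulf_eq0 (negbTE w4) orbF => /eqP.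
  by rewrite divfK //; split=> //; rewrite mulrAC eqvw mulfK.
exists (v - k *: w); last by exists (k *: w); rewrite ?memvZ ?memv_line // subrK.
by rewrite mem_line34 !mxE k3 k4 !subrr eqxx.
Qed.

Lemma dim_line34 : \dim (line34 : {vspace vec}) = 2.
Proof.
rewrite /line34 dim_addv_line ?dim_vline.
  by case: eqP => // /rowP/(_ o1)/eqP; rewrite !mxE eqxx oner_eq0.
apply/vlineP => -[k /rowP/(_ o2)/eqP]; by rewrite !mxE /= mulr0 oner_eq0.
Qed.

Lemma plane_through_dim w : w \notin line34 -> is_plane (plane_through w).
Proof. by move=> wL; rewrite /is_plane dim_addv_line // dim_line34. Qed.

End Planes.

(** * Three planes and a quintic *)

Section Quintic.

Variables (K : closedFieldType) (a b c : K) (e : 'I_5 -> K).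

Notation vec := 'rV[K]_4.
Notation form := {mpoly K[4]}.

Implicit Types (P Q v : vec) (s t : K).

Local Notation X := (familyT a b c (binary_quartic e)).
Local Notation d := (b + 4%:R * a * c ^+ 3).

(** The second argument is formN as a form; the next two are the coefficients of
    s t and s^2 in the last factor of inflection_factor. *)
Definition quintic : form :=
  let N : form := a *: 'X_o3 + d *: 'X_o4 in
  resultant23 c%:MP N (3%:R *: 'X_o1 - c *: N)
    (- (3%:R *: 'X_o2) - (2%:R * c ^+ 2) *: N) 'X_o4 'X_o3.

Lemma quintic_homog : quintic \is 5.-homog.
Proof. by rewrite /quintic /resultant23; solve_homog. Qed.

Lemma meval_quintic (v : 'I_4 -> K) : quintic.@[v] =
  let N := a * v o3 + d * v o4 in
  resultant23 c N (3%:R * v o1 - c * N) (- (3%:R * v o2) - 2%:R * c ^+ 2 * N)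
    (v o4) (v o3).
Proof.
rewrite /quintic (rmorph_resultant23 (meval v)) /=.
by rewrite !(mevalD, mevalN, mevalZ, mevalC, mevalXU).
Qed.

Lemma evalv_quintic v : evalv quintic v =
  resultant23 c (formN a b c v) (3%:R * v 0 o1 - c * formN a b c v)
    (- (3%:R * v 0 o2) - 2%:R * c ^+ 2 * formN a b c v) (v 0 o4) (v 0 o3).
Proof. exact: meval_quintic. Qed.

(** On the tangent plane the values of formM and formN are u times binary forms in
    (s, t), and that of formM is divisible by (t - 2 c s)^2.  This is why
    inflection splits off three points of ell. *)
Lemma inflection_factor s t u v :
  v 0 o3 = t ^+ 2 * (t - 3%:R * c * s) * u -> v 0 o4 = - (s ^+ 3 * u) ->
  inflection a b c s t v = u * (s * t * (t - 2%:R * c * s)) *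
    (formN a b c v * t ^+ 2 + (3%:R * v 0 o1 - c * formN a b c v) * (s * t)
     + (- (3%:R * v 0 o2) - 2%:R * c ^+ 2 * formN a b c v) * s ^+ 2).
Proof. move=> v3 v4; rewrite /inflection /formM /formN v3 v4; ring. Qed.

Lemma formM_factor s t u v :
  v 0 o3 = t ^+ 2 * (t - 3%:R * c * s) * u -> v 0 o4 = - (s ^+ 3 * u) ->
  formM c v = (t - 2%:R * c * s) ^+ 2 * (t + c * s) * u.
Proof. by move=> v3 v4; rewrite /formM v3 v4; ring. Qed.

(** The two coefficients of tangency do not vanish together, so its zeros are
    parametrized by one scalar u. *)
Lemma tangency_param s t v : (s != 0) || (t != 0) -> tangency c s t v = 0 ->
  exists u, v 0 o3 = t ^+ 2 * (t - 3%:R * c * s) * u /\ v 0 o4 = - (s ^+ 3 * u).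
Proof.
have [->|s0] /= := eqVneq s 0.
  move=> t0; rewrite /tangency => T0; exists (v 0 o3 / t ^+ 3); split; first by field.
  have /eqP : t ^+ 3 * v 0 o4 = 0 by rewrite -T0; ring.
  by rewrite mulf_eq0 expf_eq0 /= (negbTE t0) => /eqP ->; ring.
move=> _; rewrite /tangency => T0; exists (- v 0 o4 / s ^+ 3); split; last by field.
apply: (mulfI (expf_neq0 3 s0)); rewrite -[LHS]subr0 -T0; field.
by rewrite s0.
Qed.

Lemma S8_off_lineE v : v \notin line34 ->
  S8 X line34 v <->
  [\/ v 0 o4 = 0, v 0 o3 = 0, formM c v = 0 | evalv quintic v = 0].
Proof.
move=> vL; rewrite S8_off_line // evalv_quintic; split.
  move=> [s [t [st T0]]].
  have [u [v3 v4]] := tangency_param st T0.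
  have u0 : u != 0.
    by apply: contra vL => /eqP u0; rewrite mem_line34 v3 v4 u0 !mulr0 oppr0 eqxx.
  rewrite (inflection_factor v3 v4) => /eqP; rewrite !mulf_eq0 (negbTE u0) /=.
  have [s0 _|s0] /= := eqVneq s 0.
    by constructor 1; rewrite v4 s0; ring.
  have [t0 _|t0] /= := eqVneq t 0.
    by constructor 2; rewrite v3 t0; ring.
  have [t2 _|_ /= /eqP q0] := eqVneq (t - 2%:R * c * s) 0.
    by constructor 3; rewrite (formM_factor v3 v4) t2 expr0n !mul0r.
  by constructor 4; apply/resultant23P; exists s, t; split.
case=> [v4|v3|M0|/resultant23P[s [t [st T0 q0]]]].
- by exists 0, 1; rewrite oner_eq0 orbT /inflection /tangency v4; split=> //; ring.
- by exists 1, 0; rewrite oner_eq0 /inflection /tangency v3; split=> //; ring.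
- exists 1, (2%:R * c); rewrite oner_eq0.
  have v3 : v 0 o3 = 4%:R * c ^+ 3 * v 0 o4 by apply/eqP; rewrite -subr_eq0; apply/eqP.
  rewrite /inflection M0 /tangency v3; split=> //; ring.
exists s, t; split=> //.
have [u [v3 v4]] := tangency_param st T0.
by rewrite (inflection_factor v3 v4) q0 mulr0.
Qed.

(** Every point of ell lies on an admissible line other than ell, since the last
    factor of inflection_factor is linear in v. *)
Lemma S8_on_line v : (3%:R != 0 :> K) -> v != 0 -> v \in line34 -> S8 X line34 v.
Proof.
move=> n3 v0 vL; have PL : on34 v by apply/on34P.
pose s := v 0 o1; pose t := v 0 o2.
suff [w [wL Tw Ew]] : exists w,
    [/\ w \notin line34, tangency c s t w = 0 & inflection a b c s t w = 0].
  exists (<[v]> + <[w]>)%VS; first exact: S_lines_span.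
  by rewrite (subvP (addvSl _ _)) ?memv_line.
have st := on34_neq0 PL v0; rewrite -/s -/t in st.
have [s0|s0] := eqVneq s 0.
  (* Over the vertex s = 0 every line of the plane x_4 = 0 is admissible. *)
  exists (delta_mx 0 o3); split.
  - by rewrite mem_line34 !mxE /= oner_eq0.
  - by rewrite /tangency !mxE s0 /=; ring.
  by rewrite /inflection /formM !mxE s0 /=; ring.
(* Elsewhere, w is the point of the tangent plane with x_1 = 0 at which the
   last factor of inflection_factor vanishes. *)
pose u := t ^+ 2 * (t - 3%:R * c * s) * a - s ^+ 3 * d.
pose w : vec := (t - 2%:R * c * s) * (t + c * s) * u / (3%:R * s ^+ 2) *: delta_mx 0 o2
  + t ^+ 2 * (t - 3%:R * c * s) *: delta_mx 0 o3 - s ^+ 3 *: delta_mx 0 o4.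
have w1 : w 0 o1 = 0 by rewrite !mxE /=; ring.
have w2 : w 0 o2 = (t - 2%:R * c * s) * (t + c * s) * u / (3%:R * s ^+ 2).
  by rewrite !mxE /= mulr1 !mulr0 addr0 subr0.
have w3 : w 0 o3 = t ^+ 2 * (t - 3%:R * c * s) * 1 by rewrite !mxE /=; ring.
have w4 : w 0 o4 = - (s ^+ 3 * 1) by rewrite !mxE /=; ring.
exists w; split.
- by rewrite mem_line34 w4 mulr1 oppr_eq0 expf_eq0 /= (negbTE s0) andbF.
- by rewrite /tangency w3 w4; ring.
rewrite (inflection_factor w3 w4) w1 w2 /formN w3 w4 /u.
by field; rewrite n3 s0.
Qed.

End Quintic.

Section ThreePlanes.

Variables (K : closedFieldType) (a b c : K) (e : 'I_5 -> K).
Hypotheses (n2 : 2%:R != 0 :> K) (n3 : 3%:R != 0 :> K) (c0 : c != 0).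

Notation vec := 'rV[K]_4.
Local Notation X := (familyT a b c (binary_quartic e)).

Let w3 : vec := delta_mx 0 o3.
Let w4 : vec := delta_mx 0 o4.
Let wM : vec := 4%:R * c ^+ 3 *: delta_mx 0 o3 + delta_mx 0 o4.

Lemma S8_three_planes_quintic : irreducible_form (quintic a b c) ->
  three_planes_and_quintic (S8 X line34).
Proof.
move=> irrQ.
have w3L : w3 \notin line34 by rewrite mem_line34 !mxE /= oner_eq0.
have w4L : w4 \notin line34 by rewrite mem_line34 !mxE /= oner_eq0 andbF.
have wML : wM \notin line34.
  by rewrite mem_line34 !mxE /= mulr0 add0r oner_eq0 andbF.
have n4c : 4%:R * c ^+ 3 != 0.
  by rewrite (natrM _ 2 2) !mulf_neq0 ?expf_neq0.
have in3 v : (v \in plane_through w3) = (v 0 o4 == 0).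
  by rewrite plane_throughP // !mxE /= mulr0 mulr1 eq_sym.
have in4 v : (v \in plane_through w4) = (v 0 o3 == 0).
  by rewrite plane_throughP // !mxE /= mulr0 mulr1.
have inM v : (v \in plane_through wM) = (formM c v == 0).
  rewrite /formM.
  rewrite plane_throughP // !mxE /= !mulr0 !mulr1 addr0 add0r mulr1 subr_eq0.
  by rewrite [_ * v 0 _]mulrC.
exists (plane_through w3), (plane_through w4), (plane_through wM), (quintic a b c).
split; split; try exact: plane_through_dim.
- have mem_w (w : vec) : w \in plane_through w by rewrite (subvP (addvSr _ _)) ?memv_line.
  rewrite /= !inE negb_or andbT -andbA; apply/and3P; split; apply/eqP => eqH.
  + by have := mem_w w4; rewrite -eqH in3 !mxE /= oner_eq0.
  + by have := mem_w wM; rewrite -eqH in3 !mxE /= mulr0 add0r oner_eq0.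
  by have := mem_w wM; rewrite -eqH in4 !mxE /= mulr1 addr0 (negbTE n4c).
- split; first exact: quintic_homog.
  by case: irrQ.
- exact: irrQ.
move=> v v0; rewrite in3 in4 inM /vanishes.
have [vL|vL] := boolP (v \in line34).
  split=> _; last exact: S8_on_line.
  by constructor 1; case/on34P: vL => _ ->.
rewrite S8_off_lineE //; split; case.
- by move=> ->; constructor 1.
- by move=> ->; constructor 2.
- by move=> ->; constructor 3.
- by constructor 4.
- by move/eqP; constructor 1.
- by move/eqP; constructor 2.
- by move/eqP; constructor 3.
by constructor 4.
Qed.

End ThreePlanes.

(** * Gradings and divisors of monomials *)

Section Grading.

Variables (K : fieldType) (n : nat).
Notation form := {mpoly K[n]}.
Implicit Types (w : 'I_n -> nat) (f g : form) (m : 'X_{1..n}).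

(** The substitution x_i := x_i z^(w i).  The coefficients of the resulting
    polynomial in z are the homogeneous components of f for the weights w. *)
Definition grade_def w f : {poly form} :=
  mmap (polyC \o @mpolyC n K) (fun i => ('X_i : form)%:P * 'X^(w i)) f.
Fact grade_key : unit. Proof. by []. Qed.
(** The definition is sealed so that only the rules below unfold it. *)
Definition grade := locked_with grade_key grade_def.
Lemma grade_unlock : grade = grade_def. Proof. exact: unlock. Qed.

Lemma grade0 w : grade w 0 = 0.
Proof. by rewrite grade_unlock; apply: mmap0. Qed.
Lemma gradeD w f g : grade w (f + g) = grade w f + grade w g.
Proof. rewrite grade_unlock; exact: mmapD. Qed.
Lemma gradeB w f g : grade w (f - g) = grade w f - grade w g.
Proof. rewrite grade_unlock; exact: mmapB. Qed.
Lemma gradeN w f : grade w (- f) = - grade w f.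
Proof. rewrite grade_unlock; exact: mmapN. Qed.
Lemma gradeM w f g : grade w (f * g) = grade w f * grade w g.
Proof. rewrite grade_unlock; exact: rmorphM. Qed.
Lemma gradeXn w f k : grade w (f ^+ k) = grade w f ^+ k.
Proof. rewrite grade_unlock; exact: rmorphXn. Qed.
Lemma gradeZ w (c : K) f : grade w (c *: f) = (c%:MP)%:P * grade w f.
Proof. rewrite grade_unlock; exact: mmapZ. Qed.
Lemma gradeC w (c : K) : grade w c%:MP = (c%:MP)%:P.
Proof. by rewrite grade_unlock /grade_def mmapC. Qed.
Lemma grade_var w i : grade w 'X_i = ('X_i)%:P * 'X^(w i).
Proof. by rewrite grade_unlock /grade_def mmapX mmap1U. Qed.
Definition gradeE := (gradeD, gradeB, gradeN, gradeM, gradeXn, gradeZ, grade_var).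

Lemma grade_resultant23 w (c p q r D F : form) :
  grade w (resultant23 c p q r D F) = resultant23 (grade w c) (grade w p)
    (grade w q) (grade w r) (grade w D) (grade w F).
Proof. by rewrite grade_unlock; exact: (rmorph_resultant23 (mmap _ _)). Qed.

Lemma grade_monomial w m : grade w 'X_[m] = ('X_[m])%:P * 'X^(\sum_i w i * m i).
Proof.
rewrite grade_unlock /grade_def mmapX /mmap1 -prodrXr.
rewrite -mmap1_id /mmap1 rmorph_prod -big_split; apply: eq_bigr => i _ /=.
by rewrite exprMn -exprM rmorphXn.
Qed.

Lemma grade_horner1 w f : (grade w f).[1] = f.
Proof.
elim/mpolyind: f => [|k m f _ _ IH]; first by rewrite grade0 horner0.
rewrite gradeD gradeZ grade_monomial hornerD IH !hornerM hornerXn !hornerC.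
by rewrite expr1n mulr1 mul_mpolyC.
Qed.

Lemma grade_term w (k : K) m :
  grade w (k *: 'X_[m]) = (k *: 'X_[m])%:P * 'X^(\sum_i w i * m i).
Proof. by rewrite gradeZ grade_monomial mulrA -polyCM mul_mpolyC. Qed.

Lemma grade_coef w f i : grade w (grade w f)`_i = ((grade w f)`_i)%:P * 'X^i.
Proof.
elim/mpolyind: f => [|k m f _ _ IH]; first by rewrite grade0 coef0 grade0 mul0r.
have termE : grade w (grade w (k *: 'X_[m]))`_i = ((grade w (k *: 'X_[m]))`_i)%:P * 'X^i.
  rewrite grade_term coefCM coefXn; case: eqP => [->|_].
    by rewrite mulr1 grade_term.
  by rewrite mulr0 grade0 mul0r.
have addE (p q : {poly form}) : grade w p`_i = (p`_i)%:P * 'X^i ->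
    grade w q`_i = (q`_i)%:P * 'X^i -> grade w (p + q)`_i = ((p + q)`_i)%:P * 'X^i.
  by move=> hp hq; rewrite coefD gradeD hp hq polyCD mulrDl.
have /esym gE := gradeD w (k *: 'X_[m]) f.
by case: _ / gE; apply: addE.
Qed.

(** The component of weight 0 is obtained by setting to 0 the variables of positive
    weight. *)
Lemma meval_grade0 w f v :
  ((grade w f)`_0).@[v] = f.@[fun i => 0 ^+ w i * v i].
Proof.
elim/mpolyind: f => [|k m f _ _ IH]; first by rewrite grade0 coef0 !meval0.
rewrite gradeD coefD [LHS]mevalD [RHS]mevalD IH; apply: (congr1 (+%R^~ _)).
rewrite grade_term coefCM coefXn mevalM !mevalZ !mevalX.
rewrite [in RHS](eq_bigr (fun i => (0 ^+ (w i * m i)) * v i ^+ m i)) => [|i _];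
  last first.
  by rewrite exprMn exprM.
rewrite big_split /= prodrXr expr0n eq_sym.
by case: eqP => _; rewrite ?meval1 ?meval0 ?mulr1 ?mul1r ?mulr0 ?mul0r ?mulr0.
Qed.

Lemma grade_pos_coef0 w f : (forall i, (0 < w i)%N) ->
  (grade w f)`_0 = (f.@[fun=> 0])%:MP.
Proof.
move=> w_gt0; elim/mpolyind: f => [|k m f _ _ IH].
  by rewrite grade0 coef0 meval0 mpolyC0.
rewrite gradeD coefD mevalD mpolyCD IH; apply: (congr1 (+%R^~ _)).
rewrite grade_term coefCM coefXn mevalZ mevalX.
have [->|m0] := eqVneq m 0%MM.
  rewrite !big1 => [|i _|i _]; rewrite ?mnm0E ?muln0 ?expr0 //.
  by rewrite !mulr1 mpolyX0 -mul_mpolyC mulr1.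
have [i mi] : exists i, (0 < m i)%N.
  apply/existsP; apply: contraR m0; rewrite negb_exists => /forallP h.
  by apply/eqP/mnmP => i; rewrite mnm0E; have := h i; rewrite lt0n negbK => /eqP.
rewrite (bigD1 i) //= (bigD1 i isT) /= expr0n [m i == 0]eqn0Ngt mi mul0r mulr0 mpolyC0.
by rewrite eq_sym addn_eq0 muln_eq0 !eqn0Ngt mi w_gt0 mulr0.
Qed.

Lemma size1_grade w f : (size (grade w f) <= 1)%N -> grade w f = f%:P.
Proof. by move/size1_polyC => gf; rewrite -{2}(grade_horner1 w f) gf hornerC. Qed.

Lemma meval_indep w f v : grade w f = f%:P -> f.@[fun i => 0 ^+ w i * v i] = f.@[v].
Proof. by move=> gf; rewrite -meval_grade0 gf coefC. Qed.

(** The divisors of k z^r are constants times powers of z. *)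
Lemma size_factor_monomial (R : idomainType) (p q : {poly R}) k r :
  k != 0 -> p * q = k%:P * 'X^r -> (r == 0) || (p`_0 != 0) -> size p = 1%N.
Proof.
move=> k0; elim: r q => [|r IH] q /= pq; last first.
  move=> p0; have q0 : q`_0 = 0.
    have /eqP : (p * q)`_0 = 0 by rewrite pq coefCM coefXn mulr0.
    by rewrite -!horner_coef0 hornerM mulf_eq0 -[p.[_] == 0]negbK horner_coef0 p0 => /eqP.
  have /factor_theorem[q' def_q] : root q 0 by rewrite /root horner_coef0 q0.
  apply: (IH q'); last by rewrite p0 orbT.
  have X0 : 'X != 0 :> {poly R} by rewrite polyX_eq0.
  by apply: (mulIf X0); rewrite -[RHS]mulrA -exprSr -pq def_q subr0 mulrA.
move=> _; rewrite expr0 mulr1 in pq.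
have pq0 : p * q != 0 by rewrite pq polyC_eq0.
have := size_mul_eq1 p q; rewrite pq size_polyC k0 => /esym.
by rewrite eqxx => /andP[/eqP].
Qed.

(** A divisor u of a monomial is free of the variables of positive weight as soon
    as these do not occur in the monomial, or u survives setting them to 0. *)
Lemma grade_factor_monomial w (u g : form) k m v : k != 0 -> u * g = k *: 'X_[m] ->
  (\sum_i w i * m i == 0)%N || (u.@[fun i => 0 ^+ w i * v i] != 0) ->
  grade w u = u%:P.
Proof.
move=> k0 ug hw; apply: size1_grade.
suff -> : size (grade w u) = 1%N by [].
apply: (@size_factor_monomial _ _ (grade w g) (k *: 'X_[m]) (\sum_i w i * m i)).
- apply: contraNneq k0 => /(congr1 (mcoeff m)).
  by rewrite mcoeffZ mcoeffX eqxx mulr1 mcoeff0 => ->.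
- by rewrite -gradeM ug grade_term.
case/orP: hw => [->//|hw]; apply/orP; right.
by apply: contraNneq hw => u0; rewrite -meval_grade0 u0 meval0.
Qed.

End Grading.

(** Only q and r involve z, and the resultant is cubic in (q, r); D, F and p have
    weight 0. *)
Lemma resultant23_top (R : comNzRingType) (c p q1 q0 r1 r0 x4 x3 : R) :
  exists S : {poly R}, (size S <= 3)%N /\
    resultant23 c%:P p%:P (q1%:P * 'X + q0%:P) (r1%:P * 'X + r0%:P) x4%:P x3%:P
    = (x4 * (x4 * r1 ^+ 2 * (r1 + 3%:R * c * q1) - x3 * q1 ^+ 3))%:P * 'X^3 + S.
Proof.
pose u1 := r1 + 3%:R * c * q1; pose u0 := r0 + 3%:R * c * q0 + 9%:R * c ^+ 2 * p.
pose R2 := x4 ^+ 2 * (2%:R * r1 * r0 * u1 + r1 ^+ 2 * u0)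
  + x3 * x4 * (- 3%:R * q1 ^+ 2 * q0 + 3%:R * q1 * r1 * p - 3%:R * c * p * q1 ^+ 2).
pose R1 := x4 ^+ 2 * (r0 ^+ 2 * u1 + 2%:R * r1 * r0 * u0)
  + x3 * x4 * (- 3%:R * q1 * q0 ^+ 2 + 3%:R * p * (q1 * r0 + q0 * r1)
        - 6%:R * c * p * q1 * q0 + 6%:R * c * r1 * p ^+ 2).
pose R0 := resultant23 c p q0 r0 x4 x3.
exists (Poly [:: R0; R1; R2]); split; first exact: size_Poly.
by rewrite /= !cons_poly_def mul0r add0r /R0 /R1 /R2 /u1 /u0 /resultant23; ring.
Qed.

Section QuinticLead.

Variables (K : closedFieldType) (a b c : K).
Notation form := {mpoly K[4]}.
Local Notation d := (b + 4%:R * a * c ^+ 3).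

Definition coords (x1 x2 x3 x4 : K) : 'I_4 -> K := fun i => nth 0 [:: x1; x2; x3; x4] i.
Definition weights (w1 w2 w3 w4 : nat) : 'I_4 -> nat :=
  fun i => nth 0%N [:: w1; w2; w3; w4] i.

(** Up to the factor - 27 x_4, these are the terms of X that are linear in
    (x_3, x_4). *)
Definition quintic_lead : form :=
  - 27%:R *: ('X_o4 * ('X_o1 ^+ 3 * 'X_o3
                   + 'X_o2 ^+ 2 * ('X_o2 - (3%:R * c) *: 'X_o1) * 'X_o4)).

Lemma quintic_grade_lead : exists R : {poly form}, (size R <= 3)%N /\
  grade (weights 1 1 0 0) (quintic a b c) = quintic_lead%:P * 'X^3 + R.
Proof.
pose N : form := a *: 'X_o3 + d *: 'X_o4.
have [R [sR eqR]] := resultant23_top c%:MP N (3%:R *: 'X_o1) (- (c *: N))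
  (- (3%:R *: 'X_o2)) (- ((2%:R * c ^+ 2) *: N)) ('X_o4 : form) 'X_o3.
exists R; split; first exact: sR.
have -> : quintic_lead = 'X_o4 * ('X_o4 * (- (3%:R *: 'X_o2)) ^+ 2
      * (- (3%:R *: 'X_o2) + 3%:R * c%:MP * (3%:R *: 'X_o1))
    - 'X_o3 * (3%:R *: 'X_o1) ^+ 3).
  by rewrite /quintic_lead -!mul_mpolyC; ring.
rewrite -eqR /quintic grade_resultant23 gradeC.
have gN : grade (weights 1 1 0 0) N = N%:P.
  by rewrite /N !gradeE /weights /= expr0 !mulr1 -!polyCM -polyCD !mul_mpolyC.
have gZ (k : K) i j : weights 1 1 0 0 i = j ->
    grade (weights 1 1 0 0) (k *: 'X_i) = (k *: 'X_i)%:P * 'X^j.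
  by move=> <-; rewrite gradeZ grade_var mulrA -polyCM mul_mpolyC.
have gq : grade (weights 1 1 0 0) (3%:R *: 'X_o1 - c *: N)
    = (3%:R *: 'X_o1)%:P * 'X + (- (c *: N))%:P.
  by rewrite gradeB (gZ _ o1 1%N erefl) gradeZ gN -polyCM mul_mpolyC polyCN.
have gr : grade (weights 1 1 0 0) (- (3%:R *: 'X_o2) - (2%:R * c ^+ 2) *: N)
    = (- (3%:R *: 'X_o2))%:P * 'X + (- ((2%:R * c ^+ 2) *: N))%:P.
  rewrite gradeB gradeN (gZ _ o2 1%N erefl) gradeZ gN -[in LHS]polyCM mul_mpolyC.
  rewrite ![in RHS]polyCN.
  by rewrite mulNr.
by rewrite gN gq gr !grade_var !expr0 !mulr1.
Qed.

End QuinticLead.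

(** * Irreducibility of the quintic *)

Lemma mevalXn n (R : comNzRingType) (f : {mpoly R[n]}) k v : (f ^+ k).@[v] = f.@[v] ^+ k.
Proof. exact: rmorphXn. Qed.
Definition mevalEs := (mevalD, mevalB, mevalN, mevalM, mevalZ, mevalXn, mevalXU).

Section Irreducible.

Variables (K : closedFieldType) (a b c : K).
Hypotheses (n3 : 3%:R != 0 :> K) (a0 : a != 0).

Notation form := {mpoly K[4]}.
Local Notation w12 := (weights 1 1 0 0).

Definition lead_coef3 : form := - 27%:R *: ('X_o4 * 'X_o1 ^+ 3 * 'X_o3).
Definition lead_const3 : form :=
  - 27%:R *: ('X_o4 ^+ 2 * 'X_o2 ^+ 2 * ('X_o2 - (3%:R * c) *: 'X_o1)).

Lemma quintic_lead_grade3 : grade (weights 0 0 1 0) (quintic_lead c)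
  = lead_coef3%:P * 'X + lead_const3%:P.
Proof.
rewrite /quintic_lead /lead_coef3 /lead_const3 -!mul_mpolyC !gradeE !gradeC.
rewrite /weights /= expr0 expr1 !mulr1.
move: (- 27%:R)%:MP (3%:R * c)%:MP => k k'.
move: ('X_o1 : form) ('X_o2 : form) ('X_o3 : form) ('X_o4 : form) => x1 x2 x3 x4; ring.
Qed.

Lemma natr27_neq0 : - 27%:R != 0 :> K.
Proof. by rewrite oppr_eq0 (natrM _ 9 3) (natrM _ 3 3) !mulf_neq0. Qed.

Lemma quintic_at3 : (quintic a b c).@[coords 0 0 1 0] = a ^+ 3.
Proof. by rewrite meval_quintic /coords /resultant23 /=; ring. Qed.

Lemma lead_coef3_monomial : lead_coef3 = - 27%:R *: 'X_[U_(o4) + U_(o1) *+ 3 + U_(o3)].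
Proof. by rewrite /lead_coef3 mpolyXn -!mpolyXD. Qed.

(** Let u be the leading (x_1, x_2)-part of g.  If u is free of x_3, it divides both the
    x_3-part lead_coef3 and the x_3-free part lead_const3 of quintic_lead.  The
    first is a monomial, and the second does not vanish at (0 : 1 : 0 : 1), so u
    is a scalar multiple of a power of x_4. *)
Lemma quintic_factor_unit (g h : form) : quintic a b c = g * h ->
  lead_coef (grade w12 g) * lead_coef (grade w12 h) = quintic_lead c ->
  (size (grade (weights 0 0 1 0) (lead_coef (grade w12 g))) <= 1)%N ->
  g \is a GRing.unit.
Proof.
set u := lead_coef (grade w12 g); set v := lead_coef _ => Qgh uv su.
have gu := size1_grade su.
pose gv := grade (weights 0 0 1 0) v.
have eq1 : u%:P * gv = lead_coef3%:P * 'X + lead_const3%:P.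
  by rewrite -quintic_lead_grade3 -uv gradeM gu.
have uA : u * gv`_1 = lead_coef3.
  have := congr1 (fun p : {poly form} => p`_1) eq1.
  by rewrite coefCM coefD coefCM coefX coefC /= mulr1 addr0.
have uB : u * gv`_0 = lead_const3.
  have := congr1 (fun p : {poly form} => p`_0) eq1.
  by rewrite coefCM coefD coefCM coefX coefC /= mulr0 add0r.
have u01 : u.@[coords 0 1 0 1] != 0.
  have : lead_const3.@[coords 0 1 0 1] != 0.
    have -> : lead_const3.@[coords 0 1 0 1] = - 27%:R.
      by rewrite /lead_const3 !mevalEs /coords /=; ring.
    exact: natr27_neq0.
  by rewrite -uB mevalM mulf_eq0 negb_or => /andP[].
move: uA; rewrite lead_coef3_monomial => uA.
have indep w x := grade_factor_monomial (w := w) (v := x) natr27_neq0 uA.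
have wt w :
    (\sum_i w i * (U_(o4) + U_(o1) *+ 3 + U_(o3))%MM i = w o4 + (w o1 * 3 + w o3))%N.
  have mE i : (U_(o4) + U_(o1) *+ 3 + U_(o3))%MM i
      = ((o4 == i) + (o1 == i) * 3 + (o3 == i))%N.
    by rewrite 2!mnmDE mulmnE !mnm1E.
  rewrite (bigD1 o4) //= (bigD1 o1) //= (bigD1 o3) //=.
  rewrite big1 => [|i /andP[/andP[n4 n1] n3']].
    by rewrite !mE /= !muln1 ?addn0 ?add0n.
  by rewrite mE ![_ == i]eq_sym (negbTE n4) (negbTE n1) (negbTE n3') muln0.
(* x_2 does not occur in lead_coef3, so u is free of x_2. *)
have i2 : grade (weights 0 1 0 0) u = u%:P.
  by apply: (indep _ (coords 0 0 0 0)); rewrite wt.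
have meval_ext (z w : 'I_4 -> K) : z =1 w -> forall f : form, f.@[z] = f.@[w].
  by move=> zw f; apply: meval_eq.
have u4 : u.@[coords 0 0 0 1] != 0.
  rewrite -(meval_indep (coords 0 1 0 1) i2) in u01; move: u01; congr (_ != _).
  by apply: meval_ext => i; case: (ord4P i) => ->; rewrite /coords /weights /=; ring.
have i12 : grade w12 u = u%:P.
  apply: (indep _ (coords 0 0 0 1)); apply/orP; right; move: u4; congr (_ != _).
  by apply: meval_ext => i; case: (ord4P i) => ->; rewrite /coords /weights /=; ring.
have u0 : u != 0 by apply: contraNneq u4 => ->; rewrite meval0.
(* The leading coefficient u has the same (x_1, x_2)-degree as g; it is free of
   x_1 and x_2, hence so is g. *)
have gg : (size (grade w12 g) <= 1)%N.
  have := grade_coef w12 g (size (grade w12 g)).-1.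
  rewrite -/(lead_coef _) -/u i12; case: (size _) => [|[|k]] //=.
  move=> /(congr1 (fun p : {poly form} => p`_0)).
  by rewrite coefC coefCM coefXn /= mulr0 => /eqP; rewrite (negbTE u0).
have gE : g = u by rewrite /u (size1_grade gg) lead_coefC.
have i123 : grade (weights 1 1 1 0) u = u%:P.
  apply: (indep _ (coords 0 0 0 1)); apply/orP; right; move: u4; congr (_ != _).
  by apply: meval_ext => i; case: (ord4P i) => ->; rewrite /coords /weights /=; ring.
(* Now g depends on x_4 alone, and x_4 does not divide the quintic. *)
have u00 : u.@[fun=> 0] != 0.
  have : (quintic a b c).@[coords 0 0 1 0] != 0 by rewrite quintic_at3 expf_neq0.
  rewrite Qgh mevalM mulf_eq0 negb_or gE => /andP[+ _].
  rewrite -(meval_indep (coords 0 0 1 0) i123); congr (_ != _).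
  by apply: meval_ext => i; case: (ord4P i) => ->; rewrite /coords /weights /=; ring.
have w1 i : (0 < weights 1 1 1 1 i)%N by case: (ord4P i) => ->.
have iall : grade (weights 1 1 1 1) u = u%:P.
  apply: (indep _ (coords 0 0 0 0)); apply/orP; right; move: u00; congr (_ != _).
  by apply: meval_ext => i; case: (ord4P i) => ->; rewrite /coords /weights /=; ring.
have := grade_pos_coef0 u w1; rewrite iall coefC /= -gE => ->.
by rewrite rmorph_unit // unitfE gE.
Qed.

(** quintic_lead has degree 1 in x_3, so the leading part of one of the two factors
    is free of x_3. *)
Lemma quintic_irreducible : irreducible_form (quintic a b c).
Proof.
have Q3 : quintic a b c != 0.
  have : (quintic a b c).@[coords 0 0 1 0] != 0 by rewrite quintic_at3 expf_neq0.
  by apply: contraNneq => ->; rewrite meval0.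
split=> //.
  apply/negP => /divrr Qinv; have := congr1 (meval (fun=> 0)) Qinv.
  rewrite mevalM meval1 => /eqP; rewrite [X in X * _](_ : _ = 0).
    by rewrite mul0r eq_sym oner_eq0.
  by rewrite meval_quintic /resultant23; ring.
move=> g h Qgh.
have [R [sR gQ]] := quintic_grade_lead a b c.
have L0 : quintic_lead c != 0.
  apply/eqP => L0; have := congr1 (fun p : {poly form} => p`_1) quintic_lead_grade3.
  rewrite L0 grade0 coef0 coefD coefCM coefX coefC /= mulr1 addr0 lead_coef3_monomial.
  move/(congr1 (mcoeff (U_(o4) + U_(o1) *+ 3 + U_(o3)))).
  by rewrite mcoeffZ mcoeffX eqxx mulr1 mcoeff0 => /esym/eqP; rewrite (negbTE natr27_neq0).
have uv : lead_coef (grade w12 g) * lead_coef (grade w12 h) = quintic_lead c.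
  rewrite -lead_coefM -gradeM -Qgh gQ lead_coefDl; last first.
    rewrite size_Cmul ?size_polyXn //; exact: leq_trans sR _.
  by rewrite lead_coefM lead_coefC lead_coefXn mulr1.
pose su := size (grade (weights 0 0 1 0) (lead_coef (grade w12 g))).
pose sv := size (grade (weights 0 0 1 0) (lead_coef (grade w12 h))).
have : (su <= 1)%N || (sv <= 1)%N.
  have : (size (grade (weights 0 0 1 0) (quintic_lead c)) <= 2)%N.
    by rewrite quintic_lead_grade3 size_MXaddC; case: ifP => // _; rewrite ltnS size_polyC_leq1.
  rewrite -uv gradeM; apply: contraTT; rewrite negb_or -!ltnNge => /andP[su2 sv2].
  have nz (p : {poly form}) : (1 < size p)%N -> p != 0 by rewrite -size_poly_gt0 => /ltnW.
  by rewrite size_mul ?nz // -subn1 ltn_subRL (leq_add su2 sv2).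
case/orP => [su1|sv1]; first by left; apply: quintic_factor_unit Qgh uv su1.
by right; apply: (@quintic_factor_unit h g) => //; rewrite mulrC.
Qed.

End Irreducible.

(** * A form is determined by its zeros *)

Section Proportional.

Variable K : closedFieldType.
Notation vec := 'rV[K]_4.
Notation form := {mpoly K[4]}.

Lemma separable_poly_def (p : {poly K}) : separable_poly p = coprimep p p^`().
Proof. by rewrite unlock. Qed.

Lemma poly_zero_everywhere (p : {poly K}) : (forall z, p.[z] = 0) -> p = 0.
Proof.
by move=> pz; apply/eqP/negPn/negP => /closed_nonrootP[z]; rewrite rootE pz eqxx.
Qed.

(** A separable p has as many distinct roots as its degree. *)
Lemma vanish_on_simple_roots (p q : {poly K}) : separable_poly p ->
  (size q < size p)%N -> (forall z, root p z -> root q z) -> q = 0.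
Proof.
move=> sep sq pq; have [rs def_p] := closed_field_poly_normal p.
have p0 : p != 0 by rewrite -size_poly_gt0; case: (size p) sq.
have lp0 : lead_coef p != 0 by rewrite lead_coef_eq0.
apply/eqP; apply: contraLR sq => q0; rewrite -leqNgt def_p size_scale // size_prod_XsubC.
apply: max_poly_roots => //.
  by apply/allP => z zrs; apply: pq; rewrite def_p rootZ // root_prod_XsubC.
rewrite -separable_prod_XsubC; apply: dvdp_separable sep.
by rewrite [X in _ %| X]def_p dvdpZr.
Qed.

(** The form R = X(E) Y - Y(E) X vanishes at E, so on a line in direction E it has
    smaller degree than X; it also vanishes on the zeros of X.  Hence R is zero on
    every parallel to E that meets X transversally, and by the discriminant
    those are all but finitely many in a pencil containing the given one. *)
Lemma proportional_forms (X Y : form) d (E P0 : vec) :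
  X \is d.-homog -> Y \is d.-homog -> d%:R != 0 :> K ->
  (forall v, vanishes X v -> vanishes Y v) ->
  evalv X E != 0 -> separable_poly (restrict_to_line X P0 E) ->
  forall v, evalv X E * evalv Y v = evalv Y E * evalv X v.
Proof.
move=> hX hY d0 XY XE sep v.
pose R := evalv X E *: Y - evalv Y E *: X.
have hR : R \is d.-homog by rewrite dhomogD ?dhomogN ?dhomogZ.
have RE : evalv R E = 0 by rewrite evalvB !evalvZ mulrC subrr.
suff Rv : evalv R v = 0 by move/eqP: Rv; rewrite evalvB !evalvZ subr_eq0 => /eqP.
have sX P : size (restrict_to_line X P E) = d.+1.
  have [sz cf] := restr_homog P E hX; apply/eqP; rewrite eqn_leq sz /=.
  by rewrite ltnNge; apply: contra XE => sd; rewrite -cf nth_default.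
have sR P : (size (restrict_to_line R P E) <= d)%N.
  have [sz cf] := restr_homog P E hR; apply/leq_sizeP => j.
  rewrite leq_eqVlt => /orP[/eqP<-|dj].
    by rewrite cf.
  by rewrite nth_default // (leq_trans sz).
have good P : separable_poly (restrict_to_line X P E) -> evalv R P = 0.
  move=> sepP; have R0 : restrict_to_line R P E = 0.
    apply: vanish_on_simple_roots sepP _ _; first by rewrite sX ltnS.
    move=> z; rewrite !rootE !horner_restr => /eqP Xz.
    by rewrite evalvB !evalvZ Xz (XY _ Xz) !mulr0 subrr.
  by rewrite -[P]addr0 -(scale0r E) -horner_restr R0 horner0.
(* Join P0 to v by the line P0 + eps D.  The bivariate polynomial F restricts X
   to the plane swept by the parallels to E through that line. *)
pose D := v - P0.
pose F : {poly {poly K}} := mmap (polyC \o polyC)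
   (fun i => ((P0 0 i)%:P + D 0 i *: 'X)%:P + (E 0 i)%:P *: 'X) X.
have FE eps : map_poly (horner_eval eps) F = restrict_to_line X (P0 + eps *: D) E.
  rewrite /F /restrict_to_line /mmap rmorph_sum /=; apply: eq_bigr => m _.
  rewrite rmorphM /= map_polyC /= /horner_eval hornerC; congr (_ * _).
  rewrite /mmap1 [LHS](rmorph_prod (map_poly (horner_eval eps))).
  apply: eq_bigr => i _; rewrite rmorphXn /=; congr (_ ^+ _).
  rewrite rmorphD /= map_polyC /= map_polyZ /= map_polyX /horner_eval !hornerE !mxE.
  by rewrite [eps * _]mulrC.
have [sF cF] := @mmap_line_homog {poly K} K 4 polyC (fun i => (P0 0 i)%:P + D 0 i *: 'X)
    (fun i => (E 0 i)%:P) X d hX.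
rewrite -/F in sF cF.
have cFE : F`_d = (evalv X E)%:P.
  rewrite cF /evalv mevalE /mmap rmorph_sum; apply: eq_bigr => m _.
  rewrite rmorphM rmorph_prod; congr (_ * _); apply: eq_bigr => i _; by rewrite rmorphXn.
have sizeF : size F = d.+1.
  apply/eqP; rewrite eqn_leq sF /= ltnNge; apply: contra XE => sd.
  by rewrite -polyC_eq0 -cFE nth_default.
have F0 : F != 0 by rewrite -size_poly_eq0 sizeF.
have lF : lead_coef F = (evalv X E)%:P by rewrite lead_coefE sizeF.
have d_gt0 : (0 < d)%N by case: (d) d0; rewrite ?eqxx.
have cF' : F^`()`_d.-1 = (evalv X E *+ d)%:P.
  by rewrite coef_deriv prednK // cFE polyCMn.
have XEd : evalv X E *+ d != 0 by rewrite -mulr_natr mulf_neq0.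
have lF' : lead_coef F^`() = (evalv X E *+ d)%:P.
  have sF' : size F^`() = d.
    apply/eqP; rewrite eqn_leq -ltnS -sizeF lt_size_deriv ?F0 //=.
    rewrite -(prednK d_gt0) ltnNge; apply: contra XEd => sd.
    by rewrite -polyC_eq0 -cF' nth_default.
  by rewrite lead_coefE sF'.
(* Del is nonzero at eps = 0, hence at all but finitely many eps, and wherever
   it is nonzero the difference R vanishes. *)
pose Del := resultant F F^`().
have DelE eps : (Del.[eps] != 0) = separable_poly (restrict_to_line X (P0 + eps *: D) E).
  rewrite -[Del.[eps]]/(horner_eval eps Del) map_resultant.
  - rewrite -deriv_map FE resultant_eq0 -leqNgt unlock /separable_poly_def coprimep_def.
    have X0 : restrict_to_line X (P0 + eps *: D) E != 0 by rewrite -size_poly_eq0 sX.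
    by rewrite eqn_leq size_poly_gt0 gcdp_eq0 (negbTE X0) andbT.
  - by rewrite lF /= -[horner_eval _ _]/(_.[_]) hornerC.
  by rewrite lF' /= -[horner_eval _ _]/(_.[_]) hornerC.
have Del0 : Del != 0.
  have : Del.[0] != 0 by rewrite DelE scale0r addr0.
  by apply: contraNneq => ->; rewrite horner0.
have /eqP : restrict_to_line R P0 D * Del = 0.
  apply: poly_zero_everywhere => eps; rewrite hornerM horner_restr.
  have [->|] := eqVneq Del.[eps] 0; first by rewrite mulr0.
  by rewrite DelE => /good ->; rewrite mul0r.
rewrite mulf_eq0 (negbTE Del0) orbF => /eqP R0.
by have := horner_restr R P0 D 1; rewrite R0 horner0 scale1r addrC subrK.
Qed.

End Proportional.

(** * Segre construction *)

Section NotSegre.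

Variables (K : closedFieldType) (a b c : K) (e : 'I_5 -> K).
Hypotheses (n2 : 2%:R != 0 :> K) (n3 : 3%:R != 0 :> K).
Hypotheses (a0 : a != 0) (e00 : e (inord 0) != 0).
Hypothesis disc0 : 4%:R * c ^+ 6 * a ^+ 6 + 729%:R * e (inord 0) ^+ 2 != 0.

Notation vec := 'rV[K]_4.
Notation form := {mpoly K[4]}.

Implicit Types (P Q v : vec) (s t : K).

Local Notation X := (familyT a b c (binary_quartic e)).
Local Notation d := (b + 4%:R * a * c ^+ 3).
Local Notation M := (formM c).
Local Notation N := (formN a b c).
Local Notation e1 := (delta_mx 0 o1 : vec).
Local Notation e3 := (delta_mx 0 o3 : vec).

Lemma evalv_e3 : evalv X e3 = e (inord 0).
Proof. by rewrite evalv_family /formM /formN /binq !mxE /=; ring. Qed.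

Lemma familyT_homog : X \is 4.-homog.
Proof.
rewrite familyT_split dhomogD //; apply: (@dhomogM _ _ _ 1); rewrite ?homog_var //.
  exact: cofactor3_homog.
exact: cofactor4_homog.
Qed.

(** On the line joining (1 : 0 : 0 : 0) to (0 : 0 : 1 : 0) the equation of X is
    z + (c^2 a^2 / 3) z^3 + e_0 z^4. *)
Lemma separable_restr : separable_poly (restrict_to_line X e1 e3).
Proof.
pose p := c ^+ 2 * a ^+ 2 / 3%:R; pose w := e (inord 0).
have -> : restrict_to_line X e1 e3 = 'X + p%:P * 'X^3 + w%:P * 'X^4.
  have e1L : on34 e1 by rewrite /on34 !mxE.
  rewrite restr_family // evalv_e3 /tangency /inflection /cubic_term /formM /formN.
  rewrite !mxE /= -/w.
  rewrite [X in X%:P * 'X](_ : _ = 1); last by ring.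
  rewrite [X in _ + X%:P * 'X^2](_ : _ = 0); last by ring.
  rewrite [X in X%:P + w%:P * 'X](_ : _ = p); last by rewrite /p; ring.
  by rewrite polyC1 polyC0; ring.
rewrite separable_poly_def; apply: Pdiv.ClosedField.root_coprimep => z.
rewrite rootE !derivE !(hornerD, hornerM, hornerC, hornerXn, hornerX, hornerMn) /=.
move=> /eqP f0; apply: contra disc0 => /eqP f1.
(* At a common root z of f and f', w z^3 = 2 and p z^2 = -3, which
   contradicts disc0. *)
have z0 : z != 0.
  apply: contraNneq (oner_neq0 K) => z0; apply/eqP; rewrite -f1 z0; ring.
have g0 : 1 + p * z ^+ 2 + w * z ^+ 3 = 0.
  apply: (mulfI z0); rewrite mulr0 -f0; ring.
have wz : w * z ^+ 3 = 2%:R.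
  apply/eqP; rewrite eq_sym -subr_eq0 -(subrr 0) -{1}(mulr0 3%:R) -{1}g0 -f1.
  by apply/eqP; ring.
have pz : p * z ^+ 2 = - 3%:R.
  by apply/eqP; rewrite -subr_eq0 -g0 wz; apply/eqP; ring.
have : (4%:R * c ^+ 6 * a ^+ 6 + 729%:R * w ^+ 2) * z ^+ 6
    = 108%:R * (p * z ^+ 2) ^+ 3 + 729%:R * (w * z ^+ 3) ^+ 2 by rewrite /p; field.
have -> : 108%:R * (p * z ^+ 2) ^+ 3 + 729%:R * (w * z ^+ 3) ^+ 2 = 0.
  by rewrite pz wz; ring.
by move/eqP; rewrite mulf_eq0 expf_eq0 (negbTE z0) orbF.
Qed.

(** Moving v along the line through P changes X by the terms of order at most 3,
    which all vanish; the value is thus a function of (s : t) and u only, and can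
    be written with formM and formN. *)
Lemma osculating_value v s t : (s != 0) || (t != 0) -> tangency c s t v = 0 ->
  inflection a b c s t v = 0 -> v 0 o3 != 0 -> v 0 o4 != 0 -> M v != 0 ->
  27%:R * v 0 o4 * (evalv X v - binq e (v 0 o3) (v 0 o4)) = M v ^+ 2 * N v ^+ 3.
Proof.
move=> st Tv Ev v3n v4n Mn; have [u [v3 v4]] := tangency_param st Tv.
have s0 : s != 0 by apply: contraNneq v4n => s0; rewrite v4 s0; apply/eqP; ring.
have t0 : t != 0 by apply: contraNneq v3n => t0; rewrite v3 t0; apply/eqP; ring.
have u0 : u != 0 by apply: contraNneq v4n => u0; rewrite v4 u0; apply/eqP; ring.
have t2 : t - 2%:R * c * s != 0.
  apply: contra Mn => /eqP t2; apply/eqP.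
  by rewrite (formM_factor v3 v4) t2 expr0n !mul0r.
have v2 : v 0 o2
    = t * v 0 o1 / s + (t - 2%:R * c * s) * (t + c * s) * N v / (3%:R * s ^+ 2).
  move/eqP: Ev; rewrite (inflection_factor _ _ v3 v4) !mulf_eq0 (negbTE s0) (negbTE t0).
  rewrite (negbTE u0) (negbTE t2) /= => /eqP q0.
  have s3 : 3%:R * s ^+ 2 != 0 by rewrite mulf_neq0 ?expf_neq0.
  apply: (mulfI s3); rewrite -[LHS]addr0 -q0; field; by rewrite n3 s0.
rewrite evalv_family v2 /formM /formN v3 v4; move: (binq _ _ _) => g.
field; by rewrite n3 s0.
Qed.

Lemma linear_form_on_line (L : form) P v z : L \is 1.-homog ->
  evalv L P = 0 -> evalv L (P + z *: v) = z * evalv L v.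
Proof.
move=> hL LP; rewrite -horner_restr restr_linear // LP add0r.
by rewrite hornerM hornerC hornerX mulrC.
Qed.

(** Segre's equation differs from k X by a form in x_3 and x_4, which does not
    affect the conditions for a line through a point of ell to lie in S, except
    for the one in order 4. *)
Lemma not_segre : ~ segre_construction X line34.
Proof.
move=> [S [L [[hS S0] [Fam [famL famS]] hL XY]]].
pose H : form := \prod_(i < 4) L i.
have HE v : evalv H v = \prod_(i < 4) evalv (L i) v by exact: rmorph_prod.
have hH : H \is 4.-homog.
  rewrite /H !big_ord_recl big_ord0 mulr1.
  have h i : L i \is 1.-homog by have [[]] := hL i.
  by do 3!(apply: (@dhomogM _ _ _ 1); first exact: h); exact: h.
pose Y := S + H.
have XE : evalv X e3 != 0 by rewrite evalv_e3.
have n4 : 4%:R != 0 :> K by rewrite (natrM _ 2 2) mulf_neq0.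
have prop := @proportional_forms K X Y 4 e3 e1 familyT_homog (dhomogD hS hH) n4
  (fun v => (XY v).1) XE separable_restr.
pose k := evalv Y e3 / evalv X e3.
have k0 : k != 0.
  rewrite mulf_neq0 ?invr_eq0 //; apply: contra XE => /eqP YE; apply/eqP.
  by apply/XY.
have SE v : evalv S v = k * evalv X v - evalv H v.
  apply/eqP; rewrite eq_sym subr_eq -evalvD -/Y eq_sym; apply/eqP.
  by apply: (mulfI XE); rewrite prop /k; field.
(* A line of S through v meeting ell is an osculating line of X there: the terms
   of order 1 and 2 along it are those of k X, since H contributes only to
   order 4. *)
have key v : v 0 o3 != 0 -> v 0 o4 != 0 -> M v != 0 -> evalv S v = 0 ->
    k * (M v ^+ 2 * N v ^+ 3)
      + 27%:R * v 0 o4 * (k * binq e (v 0 o3) (v 0 o4) - evalv H v) = 0.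
  move=> v3 v4 Mv Sv.
  have v0 : v != 0 by apply: contraNneq v4 => ->; rewrite mxE.
  have [m Fm vm] := (famS v v0).1 Sv.
  have [dm mL] := famL m Fm.
  pose P := vpick (m :&: line34)%VS.
  have P0 : P != 0 by rewrite vpick0.
  have := memv_pick (m :&: line34)%VS; rewrite -/P memv_cap => /andP[Pm PL'].
  have PL : on34 P by apply/on34P.
  have LP i : evalv (L i) P = 0 by have [_ ->] := hL i.
  have Sz z : evalv S (P + z *: v) = 0.
    apply/famS; last by exists m; rewrite ?memvD ?memvZ.
    have [->|z0] := eqVneq z 0; first by rewrite scale0r addr0.
    apply: contraNneq v4 => /(congr1 (fun u : vec => u 0 o4)).
    by rewrite !mxE PL.2 add0r => /eqP; rewrite mulf_eq0 (negbTE z0).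
  have poly0 : k%:P * restrict_to_line X P v - (evalv H v)%:P * 'X^4 = 0.
    apply: poly_zero_everywhere => z.
    rewrite hornerD hornerN !hornerCM hornerXn horner_restr.
    have := Sz z; rewrite SE => <-; congr (_ - _); rewrite !HE.
    rewrite [RHS](eq_bigr (fun i => z * evalv (L i) v)) => [|i _].
      by rewrite big_split /= prodr_const card_ord mulrC.
    by rewrite linear_form_on_line //; have [[]] := hL i.
  move: poly0; rewrite restr_family //.
  set T := tangency _ _ _ _; set I := inflection _ _ _ _ _ _.
  set C := cubic_term _ _ _ _ _ _.
  move=> poly0.
  have cf i : (k%:P * (T%:P * 'X + I%:P * 'X^2 + 'X^3 * (C%:P + (evalv X v)%:P * 'X))
      - (evalv H v)%:P * 'X^4)`_i = 0 by rewrite poly0 coef0.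
  have T0 : T = 0.
    have := cf 1%N; rewrite coefB !coefCM !coefD !coefCM coefXnM coefX !coefXn /= => /eqP.
    by rewrite !(mulr0, mulr1, addr0, subr0) mulf_eq0 (negbTE k0) => /eqP.
  have I0 : I = 0.
    have := cf 2%N; rewrite coefB !coefCM !coefD !coefCM coefXnM coefX !coefXn /= => /eqP.
    by rewrite !(mulr0, mulr1, addr0, add0r, subr0) mulf_eq0 (negbTE k0) => /eqP.
  have := osculating_value (on34_neq0 PL P0) T0 I0 v3 v4 Mv => <-.
  transitivity (27%:R * v 0 o4 * evalv S v); first by rewrite SE; ring.
  by rewrite Sv mulr0.
pose ly i := evalv (L i) (delta_mx 0 o4); pose lx i := evalv (L i) e3.
pose v y r : vec := y *: delta_mx 0 o2 + (r *: delta_mx 0 o3 + delta_mx 0 o4).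
have vE y r : [/\ v y r 0 o1 = 0, v y r 0 o2 = y, v y r 0 o3 = r & v y r 0 o4 = 1].
  by rewrite !mxE /=; split; ring.
have Hv y r : evalv H (v y r) = \prod_(i < 4) (ly i + r * lx i).
  rewrite HE; apply: eq_bigr => i _; have [[hi _] Li] := hL i.
  have L2 : evalv (L i) (y *: delta_mx 0 o2) = 0.
    by apply: Li; rewrite memvZ // mem_line34 !mxE /= eqxx.
  rewrite /v -[r *: _ + _]scale1r linear_form_on_line // mul1r addrC.
  rewrite -[delta_mx 0 o4 + _]/(delta_mx 0 o4 + r *: e3) -horner_restr restr_linear //.
  by rewrite hornerD hornerM !hornerC hornerX mulrC.
pose G : {poly K} :=
  Poly [:: e (inord 4); e (inord 3); e (inord 2); e (inord 1); e (inord 0)].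
have GE r : G.[r] = binq e r 1 by rewrite horner_Poly /= /binq; ring.
pose LL : {poly K} := \prod_(i < 4) ((ly i)%:P + lx i *: 'X) ^+ 1.
have LLE r : LL.[r] = \prod_(i < 4) (ly i + r * lx i).
  rewrite horner_prod; apply: eq_bigr => i _.
  by rewrite expr1 hornerD hornerC hornerZ hornerX mulrC.
(* Phi is the value of key at (0 : y : r : 1); its r^5 coefficient is k a^3,
   since G and LL have degree at most 4. *)
pose m3 := - (4%:R * c ^+ 3).
pose roots5 := [:: (m3, 1); (m3, 1); (d, a); (d, a); (d, a)].
pose Q5 : {poly K} := \prod_(q <- roots5)
   (q.1%:P + q.2 *: 'X) ^+ 1.
have Q5E r : Q5.[r] = (r - 4%:R * c ^+ 3) ^+ 2 * (a * r + d) ^+ 3.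
  rewrite /Q5 !big_cons big_nil /= !expr1 mulr1.
  rewrite !(hornerM, hornerD, hornerC, hornerZ, hornerX).
  by rewrite /m3; ring.
pose Phi := k%:P * Q5 + 27%:R%:P * (k%:P * G - LL).
have Phi0 : Phi != 0.
  have : Phi`_5 = k * a ^+ 3.
    rewrite /Phi coefD !coefCM coefB coefCM.
    have -> : Q5`_5 = a ^+ 3.
      have [_] := size_prod_linear roots5 (fun q => q.1) (fun q => q.2) (fun=> 1%N).
      rewrite sum1_size -/Q5 => ->; rewrite !big_cons big_nil /=; ring.
    have [sL _] := size_prod_linear (index_enum 'I_4) ly lx (fun=> 1%N).
    rewrite [LL`_5]nth_default; last by rewrite (leq_trans sL) // sum1_card card_ord.
    by rewrite [G`_5]nth_default ?(leq_trans (size_Poly _)) //; ring.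
  by apply: contra_eq_neq => ->; rewrite coef0 eq_sym mulf_neq0 ?expf_neq0.
(* A plane x_3 = r x_4 where key contradicts Phi(r) != 0. *)
have /closed_nonrootP[r] : Phi * 'X * ('X - (4%:R * c ^+ 3)%:P) != 0.
  by rewrite !mulf_neq0 ?polyX_eq0 ?polyXsubC_eq0.
rewrite rootE hornerM hornerM hornerX hornerXsubC !mulf_eq0 !negb_or -andbA.
case/and3P=> Phir r0 rm.
(* In the plane x_3 = r x_4, the condition S = 0 at (0 : y : r : 1) is a cubic
   equation for y. *)
have [//|y] := @closed_root K k [:: k * binq e r 1 - LL.[r];
  k * (3%:R^-1 * c * (r - 4%:R * c ^+ 3) * (a * r + d) ^+ 2); 0] k0.
rewrite horner_Poly /= => qy.
have [v1 v2 v3 v4] := vE y r.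
have Sv : evalv S (v y r) = 0.
  rewrite SE evalv_family Hv -LLE /formM /formN v1 v2 v3 v4 -[RHS]qy; ring.
have Mv : M (v y r) = r - 4%:R * c ^+ 3 by rewrite /formM v3 v4 mulr1.
have Nv : N (v y r) = a * r + d by rewrite /formN v3 v4 mulr1.
case/negP: Phir; apply/eqP.
have := key (v y r); rewrite Mv Nv v3 v4 oner_eq0 => /(_ r0 isT rm Sv) <-.
rewrite /Phi Hv -LLE !(hornerD, hornerM, hornerC, hornerN) Q5E GE; ring.
Qed.

End NotSegre.

(** * The general member *)

Theorem proposition6p5 (K : closedFieldType)
  (char2 : 2%N \notin [pchar K]) (char3 : 3%N \notin [pchar K]) :
  for_general_T (fun X : {mpoly K[4]} =>
    ~ segre_construction X line34 /\
    three_planes_and_quintic (S8 X line34)).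
Proof.
have n2 : 2%:R != 0 :> K by apply: contra char2 => n2; rewrite inE.
have n3 : 3%:R != 0 :> K by apply: contra char3 => n3; rewrite inE.
pose ia : 'I_8 := @Ordinal 8 0 isT; pose ic : 'I_8 := @Ordinal 8 2 isT.
pose ie : 'I_8 := @rshift 3 5 (inord 0).
(* The conditions a <> 0 (irreducibility, and the degree count in part a), e_0 <> 0
   and separability of X on the line of separable_restr. *)
pose F : {mpoly K[8]} := 'X_ia * 'X_ie *
  (4%:R *: ('X_ic ^+ 6 * 'X_ia ^+ 6) + 729%:R *: 'X_ie ^+ 2).
have FE p : F.@[p] = p ia * p ie * (4%:R * p ic ^+ 6 * p ia ^+ 6 + 729%:R * p ie ^+ 2).
  by rewrite /F !mevalEs; ring.
exists (fun p => F.@[p] != 0); split.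
- exists (fun f => f = F) => p; split=> [Fp|[f -> //]]; by exists F.
- (* The value 2/27 of e_0 makes the last factor 2^3. *)
  exists (fun i : 'I_8 => nth 0 [:: 1; 0; 1; 2%:R / 27%:R] i); last exact: oner_neq0.
  have ieE : nat_of_ord ie = 3%N by rewrite /= inordK.
  have n27 : 27%:R != 0 :> K by rewrite (natrM _ 9 3) (natrM _ 3 3) !mulf_neq0.
  rewrite FE ieE /= mul1r !expr1n !mulr1 mulf_neq0 ?mulf_neq0 ?invr_eq0 //.
  have -> : 4%:R + 729%:R * (2%:R / 27%:R) ^+ 2 = 2%:R ^+ 3 :> K by field.
  by rewrite expf_neq0.
move=> p Fp c0; move: Fp; rewrite FE !mulf_eq0 !negb_or -andbA => /and3P[a0 e0 disc].
split; first exact: not_segre.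
by apply: S8_three_planes_quintic => //; apply: quintic_irreducible.
Qed.
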